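(* Consider the stochastic linear bandit model and the LinIMED-3 algorithm described in the context. Suppose Assumption 1 holds, $\sqrt{\lambda}S\ge 1$, and $C\ge 1$ is a constant. Then the expected cumulative regret of LinIMED-3 satisfies $$R_T \le O\big(d\sqrt{T}\log(T)\big),$$ where the constant in $O(\cdot)$ does not depend on $T$ or $d$.
   Context: Stochastic linear bandit model: at each round $t=1,\dots,T$ the learner observes an arm set $\mathcal{A}_t$ (possibly infinite), each arm $a\in\mathcal{A}_t$ having a known context vector $x_{t,a}\in\mathbb{R}^d$. The learner chooses $A_t\in\mathcal{A}_t$, writes $X_t:=x_{t,A_t}$, and observes $Y_t=\langle\theta^*,X_t\rangle+\eta_t$, where $\theta^*\in\mathbb{R}^d$ is unknown and $\eta_t$ is $R$-sub-Gaussian conditionally on $A_1,\dots,A_t,Y_1,\dots,Y_{t-1}$, i.e. $\mathbb{E}[\exp(\lambda'\eta_t)\mid A_1,\dots,A_t,Y_1,\dots,Y_{t-1}]\le\exp(\lambda'^2R^2/2)$ a.s. for all $\lambda'\in\mathbb{R}$. The expected cumulative regret is $R_T=\mathbb{E}\big[\sum_{t=1}^T \max_{a\in\mathcal{A}_t}\langle\theta^*,x_{t,a}\rangle-\langle\theta^*,X_t\rangle\big]$. Assumption 1: $\|x_{t,a}\|\le L$ for all $t,a$ (in particular $\|X_t\|\le L$), $\|\theta^*\|\le S$, and $\max_{a\in\mathcal{A}_t}\langle\theta^*,x_{t,a}\rangle-\langle\theta^*,x_{t,b}\rangle\le 1$ for all $t$ and $b\in\mathcal{A}_t$. Notation: $\|x\|_A=\sqrt{x^\top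 Ax}$; $a\wedge b=\min(a,b)$. LinIMED-$x$ ($x\in\{1,2,3\}$), with parameters $\lambda>0$, $C\ge1$, horizon $T$: set $V_0=\lambda I_d$, $W_0=0$, $\hat\theta_{t}=V_{t}^{-1}W_{t}$. At round $t$, with $\gamma=1/t^2$, set $\beta_{t-1}=\big(R\sqrt{d\log\frac{1+(t-1)L^2/\lambda}{\gamma}}+\sqrt\lambda S\big)^2$. For each $a\in\mathcal{A}_t$ let $\hat\mu_{t,a}=\langle\hat\theta_{t-1},x_{t,a}\rangle$ and $\mathrm{UCB}_t(a)=\hat\mu_{t,a}+\sqrt{\beta_{t-1}}\|x_{t,a}\|_{V_{t-1}^{-1}}$. For $x\in\{1,2\}$, $\hat\Delta_{t,a}=\max_{j}\hat\mu_{t,j}-\hat\mu_{t,a}$ and the ''leader'' is $\arg\max_j\hat\mu_{t,j}$; for $x=3$, $\hat\Delta_{t,a}=\max_j\mathrm{UCB}_t(j)-\mathrm{UCB}_t(a)$ and the leader is $\arg\max_j\mathrm{UCB}_t(j)$. Writing $g_{t,a}=\beta_{t-1}\|x_{t,a}\|^2_{V_{t-1}^{-1}}$, the index of the leader $a$ is $I_{t,a}=-\log g_{t,a}$ (LinIMED-1), $I_{t,a}=\log T\wedge(-\log g_{t,a})$ (LinIMED-2), $I_{t,a}=\log\frac{C}{\max_{b\in\mathcal{A}_t}\hat\Delta_{t,b}^2}\wedge(-\log g_{t,a})$ (LinIMED-3); for every other arm $I_{t,a}=\hat\Delta_{t,a}^2/g_{t,a}-\log g_{t,a}$. The algorithm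 pulls $A_t=\arg\min_a I_{t,a}$ (ties arbitrary), observes $Y_t$, and updates $V_t=V_{t-1}+X_tX_t^\top$, $W_t=W_{t-1}+Y_tX_t$. *)

(* Defs.v *)
From HB Require Import structures.
From mathcomp Require Import all_boot all_order all_algebra.
From mathcomp Require Import all_classical all_reals all_analysis.
Set Implicit Arguments. Unset Strict Implicit. Unset Printing Implicit Defensive.
Import Order.TTheory GRing.Theory Num.Theory.
Import numFieldNormedType.Exports.
Local Open Scope classical_set_scope.
Local Open Scope ring_scope.

(* Vectors of R^d are row vectors 'rV[R]_d. Rounds are indexed t = 1, ..., T;
   index 0 of the sequences is unused. *)
Section LinIMED.
Variables (R : realType) (d : nat).

Definition dotv (u v : 'rV[R]_d) : R := (u *m v^T) 0 0.
Definition enorm (u : 'rV[R]_d) : R := Num.sqrt (dotv u u).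
Definition wnorm2 (A : 'M[R]_d) (x : 'rV[R]_d) : R := (x *m A *m x^T) 0 0.

Definition Vmat (lam : R) (X : nat -> 'rV[R]_d) (t : nat) : 'M[R]_d :=
  lam%:M + \sum_(1 <= s < t.+1) (X s)^T *m X s.
Definition Wvec (X : nat -> 'rV[R]_d) (Y : nat -> R) (t : nat) : 'rV[R]_d :=
  \sum_(1 <= s < t.+1) Y s *: X s.
Definition thetahat (lam : R) (X : nat -> 'rV[R]_d) (Y : nat -> R) (t : nat)
  : 'rV[R]_d := Wvec X Y t *m invmx (Vmat lam X t).

(* beta_{t-1} used at round t, with gamma = 1/t^2 *)
Definition beta_prev (Rn S L lam : R) (t : nat) : R :=
  let gamma := (t%:R ^+ 2)^-1 in
  (Rn * Num.sqrt (d%:R * ln ((1 + (t.-1)%:R * L ^+ 2 / lam) / gamma))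
   + Num.sqrt lam * S) ^+ 2.

(* Round-t quantities of LinIMED-3, given the realized past arms X and
   rewards Y, and the arm set At (identified with the set of context vectors). *)
Section Round.
Variables (Rn S L lam C : R) (X : nat -> 'rV[R]_d) (Y : nat -> R) (t : nat).
Variable At : set 'rV[R]_d.

Definition muhat (x : 'rV[R]_d) : R := dotv (thetahat lam X Y t.-1) x.
Definition gidx (x : 'rV[R]_d) : R :=
  beta_prev Rn S L lam t * wnorm2 (invmx (Vmat lam X t.-1)) x.
Definition ucb (x : 'rV[R]_d) : R :=
  muhat x + Num.sqrt (beta_prev Rn S L lam t)
            * Num.sqrt (wnorm2 (invmx (Vmat lam X t.-1)) x).
Definition Dhat (x : 'rV[R]_d) : R := sup (ucb @` At) - ucb x.
Definition maxDhat2 : R := sup [set Dhat b ^+ 2 | b in At].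

Definition neglog (g : R) : \bar R := if 0 < g then (- ln g)%:E else +oo%E.
Definition idx_other (x : 'rV[R]_d) : \bar R :=
  if 0 < gidx x then (Dhat x ^+ 2 / gidx x - ln (gidx x))%:E else +oo%E.
Definition idx_leader (x : 'rV[R]_d) : \bar R :=
  Order.min (if 0 < maxDhat2 then (ln (C / maxDhat2))%:E else +oo%E)
            (neglog (gidx x)).
Definition linimed3_index (lead x : 'rV[R]_d) : \bar R :=
  if x == lead then idx_leader x else idx_other x.
End Round.

Definition hist_sigma (dsp : measure_display) (Omega : measurableType dsp)
  (X : nat -> Omega -> 'rV[R]_d) (Y : nat -> Omega -> R) (t : nat)
  : set (set Omega) :=
  <<s [set G | (exists s (i : 'I_d) (B : set R),
                   [/\ (1 <= s <= t)%N, measurable B &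
                       G = (fun w => X s w 0 i) @^-1` B])
            \/ (exists s (B : set R),
                   [/\ (1 <= s < t)%N, measurable B & G = Y s @^-1` B])] >>.

End LinIMED.

(* Main.v *)
Require Import Defs.
From HB Require Import structures.
From mathcomp Require Import all_boot all_order all_algebra.
From mathcomp Require Import all_classical all_reals all_analysis.
From mathcomp Require Import measurable_realfun ring lra.
Import Order.TTheory GRing.Theory Num.Theory.
Import numFieldNormedType.Exports.
Local Open Scope classical_set_scope.
Local Open Scope ring_scope.
Set Implicit Arguments.
Unset Strict Implicit.
Unset Printing Implicit Defensive.

(* Let V_t be the regularised design matrix, S_t the noise sum, and
   u_t = |X_t|^2 in the norm of V_{t-1}^-1.

   Confidence. If kap Rn^2 <= 1 then
   M_t = exp (kap |S_t|^2_{V_t^-1} / 2) / sqrt (prod_{s <= t} (1 + u_s))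
   is a supermartingale: by Sherman-Morrison one round multiplies it by the
   exponential of a quadratic in the noise, which is a Gaussian average of
   exponentials linear in the noise, and the random coefficients are handled by
   discretisation. The product of the 1 + u_s is det V_t / lam^d, hence at most
   (1 + t L^2 / lam)^d by Hadamard's inequality. Markov's inequality at the single
   time t - 1 shows that the confidence bound with width beta_{t-1} fails at round
   t with probability at most 1/t; this is all the room there is when d = 1, and
   it suffices because the sum of the 1/t is of order log T.

   Regret. When the bound holds, the instantaneous regret is at most the gap Dhat
   plus 2 sqrt g, with g = beta_{t-1} u_t, and comparing the index of the pulled
   arm with that of the leader gives Dhat^2 <= max (1, ln C) g. The sum of the
   regrets is then controlled by Cauchy-Schwarz and min (1, u) <= 2 ln (1 + u). *)

(** * Positive definite matrices *)

Definition bform (R : realType) (d : nat) (A : 'M[R]_d) (x y : 'rV[R]_d) : R :=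
  (x *m A *m y^T) 0 0.

Definition posdef (R : realType) (d : nat) (A : 'M[R]_d) : Prop :=
  A^T = A /\ forall x : 'rV[R]_d, x != 0 -> 0 < wnorm2 A x.

Section BilinearForms.
Variables (R : realType) (d : nat).
Implicit Types (A : 'M[R]_d) (x y z : 'rV[R]_d) (c : R).

Lemma bformDl A x y z : bform A (x + y) z = bform A x z + bform A y z.
Proof. by rewrite /bform !mulmxDl mxE. Qed.

Lemma bformDr A x y z : bform A z (x + y) = bform A z x + bform A z y.
Proof. by rewrite /bform linearD /= mulmxDr mxE. Qed.

Lemma bformZl A c x y : bform A (c *: x) y = c * bform A x y.
Proof. by rewrite /bform -!scalemxAl mxE. Qed.

Lemma bformZr A c x y : bform A x (c *: y) = c * bform A x y.
Proof. by rewrite /bform linearZ /= -!scalemxAr mxE. Qed.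

Lemma bformC A x y : A^T = A -> bform A x y = bform A y x.
Proof.
move=> symA; rewrite /bform -[in LHS](trmxK (x *m A *m y^T)) mxE.
by rewrite !trmx_mul trmxK symA mulmxA.
Qed.

Lemma bform1 x y : bform 1%:M x y = dotv x y.
Proof. by rewrite /bform mulmx1. Qed.

Lemma dotvE x y : dotv x y = \sum_i x 0 i * y 0 i.
Proof. by rewrite /dotv mxE; apply: eq_bigr => i _; rewrite mxE. Qed.

Lemma dotvC x y : dotv x y = dotv y x.
Proof. by rewrite -!bform1 bformC // tr_scalar_mx. Qed.

Lemma dotv_ge0 x : 0 <= dotv x x.
Proof. by rewrite dotvE; apply: sumr_ge0 => i _; rewrite -expr2 sqr_ge0. Qed.

Lemma dotv_gt0 x : x != 0 -> 0 < dotv x x.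
Proof.
move=> x0; rewrite lt_neqAle dotv_ge0 andbT eq_sym; apply: contra x0.
rewrite dotvE psumr_eq0; last by move=> i _; rewrite -expr2 sqr_ge0.
move=> /allP h; apply/eqP/rowP => i; rewrite mxE.
by have /= := h i (mem_index_enum _); rewrite -expr2 sqrf_eq0 => /eqP.
Qed.

Lemma posdef_scalar c : 0 < c -> posdef (c%:M : 'M[R]_d).
Proof.
move=> c0; split=> [|x x0]; first exact: tr_scalar_mx.
by rewrite /wnorm2 mul_mx_scalar -scalemxAl mxE mulr_gt0 // dotv_gt0.
Qed.

Lemma wnorm2_ge0 A x : posdef A -> 0 <= wnorm2 A x.
Proof.
move=> [_ pA]; have [->|x0] := eqVneq x 0; first by rewrite /wnorm2 !mul0mx mxE.
exact/ltW/pA.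
Qed.

(** The form is nonnegative at the residual of [x] after projection on [y]; expanding it gives the
    inequality. *)
Lemma bform_CS A x y : posdef A -> bform A x y ^+ 2 <= wnorm2 A x * wnorm2 A y.
Proof.
move=> pA; have [->|y0] := eqVneq y 0.
  by rewrite /bform /wnorm2 trmx0 !mulmx0 !mxE expr0n mulr0.
have yy : 0 < wnorm2 A y by exact: pA.2.
have := wnorm2_ge0 (x - (bform A x y / wnorm2 A y) *: y) pA.
rewrite -[wnorm2 A (_ - _)]/(bform A _ _) -scaleNr !(bformDl, bformDr, bformZl, bformZr).
rewrite (bformC y x pA.1) -[bform A x x]/(wnorm2 A x) -[bform A y y]/(wnorm2 A y).
set q := wnorm2 A y in yy *; set b := bform A x y; set p := wnorm2 A x.
have -> : p + - (b / q) * b + (- (b / q) * b + - (b / q) * (- (b / q) * q))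
  = p - b ^+ 2 / q by field; rewrite gt_eqF.
by rewrite subr_ge0 ler_pdivrMr.
Qed.

(** A row killed by [A] has quadratic form 0, hence vanishes. *)
Lemma posdef_unit A : posdef A -> A \in unitmx.
Proof.
move=> [_ pA]; rewrite -row_free_unit -kermx_eq0; apply/eqP/row_matrixP => i.
rewrite row0; apply/eqP; apply: contraT => /pA; rewrite /wnorm2.
by have /sub_kermxP-> := row_sub i (kermx A); rewrite mul0mx mxE ltxx.
Qed.

Lemma posdef_inv A : posdef A -> posdef (invmx A).
Proof.
move=> pA; have uA := posdef_unit pA; split=> [|x x0].
  by rewrite trmx_inv pA.1.
have y0 : x *m invmx A != 0.
  by apply: contra x0 => /eqP y0; rewrite -(mulmxKV uA x) y0 mul0mx.
have := pA.2 _ y0; rewrite /wnorm2 trmx_mul trmx_inv pA.1.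
by rewrite (mulmxKV uA x) mulmxA.
Qed.

Lemma wnorm2_update A x c : wnorm2 (A + c *: (x^T *m x)) =
  (fun y => wnorm2 A y + c * dotv y x ^+ 2).
Proof.
apply/funext => y; rewrite /wnorm2 mulmxDr mulmxDl mxE; congr (_ + _).
rewrite -scalemxAr -scalemxAl mxE; congr (_ * _).
rewrite mulmxA -(mulmxA (y *m x^T)) [y *m x^T]mx11_scalar mul_scalar_mx mxE expr2 -/(dotv y x).
by rewrite [X in _ * X]dotvC.
Qed.

Lemma posdef_update A x : posdef A -> posdef (A + x^T *m x).
Proof.
move=> pA; split=> [|y y0]; first by rewrite linearD /= trmx_mul trmxK pA.1.
by rewrite -[x^T *m x]scale1r wnorm2_update mul1r ltr_wpDr ?sqr_ge0 ?pA.2.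
Qed.

(** The matrix determinant lemma: the bordered matrix with blocks [1], [-x], [x^T], [A] is reduced
    to block triangular form in two ways, and the two values of its determinant are compared. *)
Lemma det_update A x : A \in unitmx ->
  \det (A + x^T *m x) = \det A * (1 + wnorm2 (invmx A) x).
Proof.
move=> uA.
have e1 : block_mx 1%:M (- x) x^T A =
    block_mx 1%:M 0 x^T 1%:M *m block_mx 1%:M (- x) 0 (A + x^T *m x).
  rewrite mulmx_block !mul1mx !mul0mx !mulmx1 !addr0 mulmxN.
  by rewrite addrCA addNr addr0.
have e2 : block_mx 1%:M (- x) x^T A *m block_mx 1%:M 0 (- (invmx A *m x^T)) 1%:M
    = block_mx (1%:M + x *m invmx A *m x^T) (- x) 0 A.
  rewrite mulmx_block !mulmx1 !mulmx0 !add0r mulmxN mulNmx opprK mulmxA.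
  by rewrite mulmxN mulKVmx // subrr.
have := congr1 determinant e2.
rewrite det_mulmx e1 det_mulmx !det_lblock !det_ublock !det1 !mul1r !mulr1 => ->.
by rewrite mulrC [_ *m x^T]mx11_scalar -raddfD det_scalar1.
Qed.

(* Sherman-Morrison, read on the quadratic form of the updated inverse. *)
Lemma wnorm2_inv_update A x z c : posdef A ->
  let u := wnorm2 (invmx A) x in
  let a := bform (invmx A) z x in
  wnorm2 (invmx (A + x^T *m x)) (z + c *: x)
  = wnorm2 (invmx A) z + (2 * c * a + c ^+ 2 * u - a ^+ 2) / (1 + u).
Proof.
move=> pA u a; have uA := posdef_unit pA.
have pI := posdef_inv pA.
have u0 : 0 <= u := wnorm2_ge0 x pI.
have u1 : 1 + u != 0 by rewrite gt_eqF // ltr_pwDl.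
(* [k] is the value of [y x^T]; with this choice [y] is the image of [z + c x] under the updated
   inverse, so the form can be read off from [y]. *)
pose k := (a + c * u) / (1 + u).
pose y := (z + c *: x - k *: x) *m invmx A.
have yE : y *m (A + x^T *m x) = z + c *: x.
  rewrite mulmxDr {1}/y mulmxKV // mulmxA [y *m x^T]mx11_scalar mul_scalar_mx.
  have -> : (y *m x^T) 0 0 = k.
    rewrite -[LHS]/(bform _ _ _) -scaleNr !(bformDl, bformZl).
    by rewrite -[bform _ x x]/u -/a /k; field.
  by rewrite subrK.
have -> : wnorm2 (invmx (A + x^T *m x)) (z + c *: x) = (y *m (z + c *: x)^T) 0 0.
  by rewrite /wnorm2 -{1}yE mulmxK // posdef_unit //; apply: posdef_update.
rewrite -[LHS]/(bform _ _ _) -scaleNr !(bformDl, bformDr, bformZl, bformZr).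
rewrite (bformC x z pI.1) -/a -[bform _ x x]/u -[bform _ z z]/(wnorm2 _ z) /k.
by field.
Qed.

End BilinearForms.

Lemma wnorm2_delta (R : realType) n (A : 'M[R]_n) i :
  wnorm2 A (delta_mx 0 i) = A i i.
Proof.
rewrite /wnorm2 -rowE trmx_delta.
by rewrite -(colE i (row i A)) !mxE.
Qed.

(* Hadamard's inequality, by induction through the Schur complement of the
   upper left entry. *)
Lemma posdef_det (R : realType) n (A : 'M[R]_n) : posdef A ->
  0 < \det A <= \prod_i A i i.
Proof.
elim: n A => [|n IH] A pA; first by rewrite det_mx00 big_ord0 ltr01 lexx.
move: A pA; rewrite -[n.+1]/(1 + n)%N => A pA.
pose a := A 0 0; pose v : 'rV[R]_n := ursubmx A; pose W : 'M[R]_n := drsubmx A.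
have a0 : 0 < a.
  rewrite /a -wnorm2_delta; apply: pA.2; apply/negP => /eqP/matrixP/(_ 0 0).
  by rewrite !mxE !eqxx /=; apply/eqP; rewrite oner_eq0.
have dlE : dlsubmx A = v^T by rewrite /v trmx_ursub pA.1.
have AE : A = block_mx a%:M v v^T W.
  rewrite -dlE -[LHS]submxK; congr (block_mx _ _ _ _).
  rewrite [LHS]mx11_scalar mxE mxE /a; congr ((A _ _)%:M); exact/val_inj.
pose S := W - a^-1 *: (v^T *m v).
have detA : \det A = a * \det S.
  have -> : A = block_mx 1%:M 0 (a^-1 *: v^T) 1%:M *m block_mx a%:M v 0 S.
    rewrite mulmx_block !mul1mx !mul0mx !addr0 AE; congr block_mx.
      by rewrite mul_mx_scalar scalerA divff ?gt_eqF // scale1r.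
    by rewrite -scalemxAl addrC subrK.
  by rewrite det_mulmx det_lblock det_ublock !det1 !mul1r det_scalar1.
have symW : W^T = W by rewrite /W trmx_drsub pA.1.
have wnormW (x : 'rV[R]_n) : wnorm2 A (row_mx 0 x) = wnorm2 W x.
  rewrite /wnorm2 AE mul_row_block !mul0mx !add0r tr_row_mx mul_row_col.
  by rewrite trmx0 mulmx0 add0r.
have pS : posdef S.
  split=> [|x x0].
    by rewrite /S linearB linearZ /= trmx_mul trmxK symW.
  have xS : - (a^-1 *: (x *m v^T)) *m v + x *m W = x *m S.
    by rewrite mulmxBr -scalemxAr mulNmx -scalemxAl mulmxA addrC.
  (* The first coordinate minimises the form of [A] for the given [x]; the minimum is the form of
     the Schur complement [S] at [x]. *)
  have := pA.2 (row_mx (- (a^-1 *: (x *m v^T))) x).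
  rewrite /wnorm2 AE mul_row_block tr_row_mx mul_row_col xS.
  rewrite mul_mx_scalar scalerN scalerA divff ?gt_eqF // scale1r addNr mul0mx.
  by rewrite add0r; apply; rewrite row_mx_eq0 negb_and x0 orbT.
have pW : posdef W.
  split=> // x x0; rewrite -wnormW; apply: pA.2.
  by rewrite row_mx_eq0 negb_and x0 orbT.
have /andP[S0 _] := IH _ pS.
have /andP[_ Wle] := IH _ pW.
(* [W] is [S] plus the rank-one square of a rescaled [v], so [det_update] multiplies the determinant
   by a factor at least 1. *)
have SW : \det S <= \det W.
  have -> : W = S + (Num.sqrt a^-1 *: v)^T *m (Num.sqrt a^-1 *: v).
    rewrite [(_ *: v)^T]linearZ /= -scalemxAl -scalemxAr scalerA -expr2 sqr_sqrtr ?subrK //.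
    by rewrite invr_ge0 ltW.
  rewrite det_update ?posdef_unit // ler_peMr ?(ltW S0) // lerDl.
  exact/wnorm2_ge0/posdef_inv.
rewrite detA mulr_gt0 //= big_ord_recl ler_pM2l //.
apply: (le_trans SW); apply: (le_trans Wle).
rewrite le_eqVlt; apply/orP; left; apply/eqP; apply: eq_bigr => i _.
by rewrite !mxE; congr (A _ _); exact/val_inj.
Qed.

(** * The design matrix and the least squares error *)

Section DesignMatrix.
Variables (R : realType) (d : nat) (lam : R).
Hypothesis lam_gt0 : 0 < lam.
Implicit Types (X : nat -> 'rV[R]_d) (x theta : 'rV[R]_d) (e : nat -> R).

Definition width X (t : nat) : R := wnorm2 (invmx (Vmat lam X t.-1)) (X t).

(** This is det V_t / lam^d, see [potentialE]; in product form, one round contributes one factor. *)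
Definition potential X (t : nat) : R := \prod_(1 <= s < t.+1) (1 + width X s).

(** [Wvec] is fed with the noises instead of the rewards, which gives the noise sum S_t. *)
Definition noise2 X e (t : nat) : R :=
  wnorm2 (invmx (Vmat lam X t)) (Wvec X e t).

Lemma Vmat0 X : Vmat lam X 0 = lam%:M.
Proof. by rewrite /Vmat big_geq // addr0. Qed.

Lemma VmatS X t : Vmat lam X t.+1 = Vmat lam X t + (X t.+1)^T *m X t.+1.
Proof. by rewrite /Vmat big_nat_recr //= addrA. Qed.

Lemma WvecS X e t : Wvec X e t.+1 = Wvec X e t + e t.+1 *: X t.+1.
Proof. by rewrite /Wvec big_nat_recr. Qed.

Lemma posdef_Vmat X t : posdef (Vmat lam X t).
Proof.
elim: t => [|t IH]; first by rewrite Vmat0; exact: posdef_scalar.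
by rewrite VmatS; exact: posdef_update.
Qed.

Lemma wnorm2_invV_ge0 X t x : 0 <= wnorm2 (invmx (Vmat lam X t)) x.
Proof. exact/wnorm2_ge0/posdef_inv/posdef_Vmat. Qed.

Lemma width_ge0 X t : 0 <= width X t.
Proof. exact: wnorm2_invV_ge0. Qed.

Lemma wnorm2_Vmat_ge X t x : lam * dotv x x <= wnorm2 (Vmat lam X t) x.
Proof.
elim: t => [|t IH].
  by rewrite Vmat0 /wnorm2 mul_mx_scalar -scalemxAl mxE.
rewrite VmatS -[_^T *m _]scale1r wnorm2_update mul1r.
by rewrite (le_trans IH) // lerDl sqr_ge0.
Qed.

(** With [y = x V^-1] and [q = <y, x>], the bound V >= lam gives lam |y|^2 <= q, and Cauchy-Schwarz
    gives q^2 <= |y|^2 |x|^2. Combine and divide by [q]. *)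
Lemma wnorm2_invV_le X t x :
  wnorm2 (invmx (Vmat lam X t)) x <= dotv x x / lam.
Proof.
have pV := posdef_Vmat X t; have uV := posdef_unit pV.
set q := wnorm2 _ _; pose y := x *m invmx (Vmat lam X t).
have qE : q = dotv y x by [].
have q0 : 0 <= q := wnorm2_invV_ge0 X t x.
have yy : lam * dotv y y <= q.
  rewrite (le_trans (wnorm2_Vmat_ge X t y)) // /wnorm2 {1}/y mulmxKV //.
  by rewrite qE dotvC.
have cs : q ^+ 2 <= dotv y y * dotv x x.
  have := bform_CS y x (posdef_scalar d (@ltr01 R)).
  by rewrite /wnorm2 !mulmx1 bform1 -qE.
have xx := dotv_ge0 x.
rewrite ler_pdivlMr //; have [->|qn0] := eqVneq q 0; first by rewrite mul0r.
have q_gt0 : 0 < q by rewrite lt_neqAle eq_sym qn0.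
rewrite -(ler_pM2l q_gt0); apply: le_trans (ler_wpM2r xx yy).
by rewrite mulrA -expr2 mulrC -mulrA ler_pM2l.
Qed.

Lemma potentialS X t : potential X t.+1 = potential X t * (1 + width X t.+1).
Proof. by rewrite /potential big_nat_recr. Qed.

Lemma potential_ge1 X t : 1 <= potential X t.
Proof.
elim: t => [|t IH]; first by rewrite /potential big_geq.
by rewrite potentialS (le_trans IH) // ler_peMr ?(le_trans ler01 IH) // lerDl width_ge0.
Qed.

Lemma potentialE X t : lam ^+ d * potential X t = \det (Vmat lam X t).
Proof.
elim: t => [|t IH].
  by rewrite Vmat0 det_scalar /potential big_geq // mulr1.
by rewrite potentialS mulrA IH VmatS det_update // posdef_unit //; exact: posdef_Vmat.
Qed.

Lemma Vmat_diag_le X t (L : R) (i : 'I_d) :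
  (forall s, (1 <= s <= t)%N -> dotv (X s) (X s) <= L ^+ 2) ->
  Vmat lam X t i i <= lam + t%:R * L ^+ 2.
Proof.
elim: t => [|t IH] hX; first by rewrite Vmat0 mxE eqxx mulr1n mul0r addr0.
rewrite VmatS mxE -natr1 mulrDl mul1r addrA lerD ?IH //.
  by move=> s /andP[s1 st]; apply: hX; rewrite s1 ltnW.
apply: le_trans (hX t.+1 _); last by rewrite ltn0Sn leqnn.
rewrite mxE big_ord_recl big_ord0 addr0 mxE dotvE (bigD1 i) //= lerDl.
by apply: sumr_ge0 => j _; rewrite -expr2 sqr_ge0.
Qed.

(** Hadamard's inequality for V_t, whose diagonal entries are at most lam + t L^2. *)
Lemma potential_le X t (L : R) :
  (forall s, (1 <= s <= t)%N -> dotv (X s) (X s) <= L ^+ 2) ->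
  potential X t <= (1 + t%:R * L ^+ 2 / lam) ^+ d.
Proof.
move=> hX; rewrite -(ler_pM2l (exprn_gt0 d lam_gt0)) potentialE -exprMn.
have /andP[_ /le_trans] := posdef_det (posdef_Vmat X t); apply.
rewrite -[X in _ ^+ X]card_ord -prodr_const; apply: ler_prod => i _.
rewrite -wnorm2_delta wnorm2_ge0 /=; last exact: posdef_Vmat.
rewrite wnorm2_delta (le_trans (Vmat_diag_le _ hX)) //.
by rewrite mulrDr mulr1 [lam * _]mulrC divfK ?gt_eqF.
Qed.

Lemma noise2S X e t :
  let u := width X t.+1 in
  let a := bform (invmx (Vmat lam X t)) (Wvec X e t) (X t.+1) in
  noise2 X e t.+1 =
  noise2 X e t + (2 * e t.+1 * a + e t.+1 ^+ 2 * u - a ^+ 2) / (1 + u).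
Proof.
by rewrite /noise2 VmatS WvecS wnorm2_inv_update //; exact: posdef_Vmat.
Qed.

(** The noiseless rewards add up to [theta] times the unregularised design matrix; this isolates the
    bias caused by [lam]. *)
Lemma Wvec_reward X e theta t :
  Wvec X (fun s => dotv theta (X s) + e s) t =
  Wvec X e t + theta *m (Vmat lam X t - lam%:M).
Proof.
elim: t => [|t IH].
  by rewrite Vmat0 subrr mulmx0 addr0 /Wvec !big_geq.
have Vstep : theta *m (Vmat lam X t.+1 - lam%:M) =
    theta *m (Vmat lam X t - lam%:M) + dotv theta (X t.+1) *: X t.+1.
  rewrite VmatS (addrAC (Vmat lam X t)) mulmxDr mulmxA.
  by rewrite [theta *m _^T]mx11_scalar mul_scalar_mx.
rewrite !WvecS IH Vstep scalerDl.
by rewrite [dotv _ _ *: _ + _ in LHS]addrC addrACA.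
Qed.

(** The error of the estimate is (S_t - lam theta) V_t^-1. Cauchy-Schwarz in the norm of V_t^-1
    treats both terms; for the bias, |theta|^2 in that norm is at most S^2 / lam, whence the factor
    sqrt(lam) S. *)
Lemma estimation_error X e theta (S : R) t x :
  let Y := fun s => dotv theta (X s) + e s in
  enorm theta <= S ->
  `|dotv (thetahat lam X Y t) x - dotv theta x| <=
  (Num.sqrt (noise2 X e t) + Num.sqrt lam * S) *
  Num.sqrt (wnorm2 (invmx (Vmat lam X t)) x).
Proof.
have pV := posdef_Vmat X t; move=> Y thS; have uV := posdef_unit pV.
have pI := posdef_inv pV.
have abs_bform z : `|bform (invmx (Vmat lam X t)) z x| <=
    Num.sqrt (wnorm2 (invmx (Vmat lam X t)) z) *
    Num.sqrt (wnorm2 (invmx (Vmat lam X t)) x).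
  by rewrite -sqrtrM ?wnorm2_invV_ge0 // -sqrtr_sqr ler_wsqrtr // bform_CS.
have -> : dotv (thetahat lam X Y t) x - dotv theta x =
    bform (invmx (Vmat lam X t)) (Wvec X e t) x
    - lam * bform (invmx (Vmat lam X t)) theta x.
  have -> : thetahat lam X Y t =
      Wvec X e t *m invmx (Vmat lam X t)
      + (theta - lam *: (theta *m invmx (Vmat lam X t))).
    rewrite /thetahat Wvec_reward mulmxDl -mulmxA mulmxBl mulmxV // mulmxBr.
    by rewrite mulmx1 mul_scalar_mx -scalemxAr.
  rewrite -!bform1 !bformDl -scaleN1r !bformZl.
  by rewrite /bform !mulmx1; ring.
rewrite mulrDl (le_trans (ler_normB _ _)) // lerD ?abs_bform //.
rewrite normrM gtr0_norm //.
apply: (@le_trans _ _ (lam * (Num.sqrt (dotv theta theta / lam) *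
   Num.sqrt (wnorm2 (invmx (Vmat lam X t)) x)))).
  rewrite ler_pM2l // (le_trans (abs_bform theta)) // ler_wpM2r ?sqrtr_ge0 //.
  by rewrite ler_wsqrtr // wnorm2_invV_le.
rewrite mulrA ler_wpM2r ?sqrtr_ge0 //.
rewrite sqrtrM ?dotv_ge0 // sqrtrV ?(ltW lam_gt0) // -/(enorm theta).
rewrite mulrA ler_pdivrMr ?sqrtr_gt0 // mulrAC -expr2 sqr_sqrtr ?(ltW lam_gt0) //.
by rewrite ler_pM2l.
Qed.

End DesignMatrix.

(** * Regret of one round *)

Lemma dotv_le (R : realType) (d : nat) (x y : 'rV[R]_d) :
  `|dotv x y| <= enorm x * enorm y.
Proof.
rewrite /enorm -sqrtrM ?dotv_ge0 // -sqrtr_sqr ler_wsqrtr //.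
have := bform_CS x y (posdef_scalar d (@ltr01 R)).
by rewrite /wnorm2 !mulmx1 bform1.
Qed.

Section Round.
Variables (R : realType) (d : nat) (Rn S L lam C : R).
Variables (X : nat -> 'rV[R]_d) (Y : nat -> R) (t : nat) (At : set 'rV[R]_d).
Hypotheses (Rn_ge0 : 0 <= Rn) (lam_gt0 : 0 < lam).
Hypotheses (lamS : 1 <= Num.sqrt lam * S) (C_ge1 : 1 <= C).
Hypothesis At_le : forall x, At x -> enorm x <= L.

Let mu := muhat lam X Y t.
Let g := gidx Rn S L lam X t.
Let U := ucb Rn S L lam X Y t.
Let D := Dhat Rn S L lam X Y t At.

Lemma dotv_bounded (theta : 'rV[R]_d) x : At x ->
  `|dotv theta x| <= enorm theta * L.
Proof.
by move=> /At_le xL; rewrite (le_trans (dotv_le _ _)) // ler_wpM2l // sqrtr_ge0.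
Qed.

(** The assumption on [Num.sqrt lam * S] enters here: the second summand inside the square is at
    least 1. Later this lets the capped regret be bounded by the width even when the width exceeds
    1. *)
Lemma beta_prev_ge1 : 1 <= beta_prev d Rn S L lam t.
Proof.
rewrite /beta_prev; set a := Rn * _.
have a0 : 0 <= a by rewrite mulr_ge0 ?sqrtr_ge0.
by rewrite exprn_ege1 // (le_trans lamS) // lerDr.
Qed.

Lemma gidx_ge0 x : 0 <= g x.
Proof.
by rewrite mulr_ge0 ?(wnorm2_invV_ge0 lam_gt0) // (le_trans ler01) ?beta_prev_ge1.
Qed.

Lemma gidx_sqrt x : Num.sqrt (beta_prev d Rn S L lam t) *
  Num.sqrt (wnorm2 (invmx (Vmat lam X t.-1)) x) = Num.sqrt (g x).
Proof. by rewrite -sqrtrM // (le_trans ler01) ?beta_prev_ge1. Qed.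

(** The arm set may be infinite and [sup] takes a default value on unbounded sets; this bound makes
    the suprema in [Dhat] and [maxDhat2] genuine. *)
Lemma ucb_bounded : exists M : R, forall x, At x -> `|U x| <= M.
Proof.
exists (enorm (thetahat lam X Y t.-1) * L +
        Num.sqrt (beta_prev d Rn S L lam t) * Num.sqrt (L ^+ 2 / lam)) => x Ax.
rewrite (le_trans (ler_normD _ _)) // lerD ?dotv_bounded //.
rewrite ger0_norm ?mulr_ge0 ?sqrtr_ge0 // ler_wpM2l ?sqrtr_ge0 // ler_wsqrtr //.
rewrite (le_trans (wnorm2_invV_le lam_gt0 _ _ _)) // ler_pM2r ?invr_gt0 //.
rewrite -(sqr_sqrtr (dotv_ge0 x)) lerXn2r ?nnegrE ?sqrtr_ge0 //; last exact: At_le.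
exact: le_trans (sqrtr_ge0 _) (At_le Ax).
Qed.

Lemma ucb_le_sup x : At x -> U x <= sup (U @` At).
Proof.
move=> Ax; have [M hM] := ucb_bounded.
apply: ub_le_sup; last by exists x.
by exists M => _ [y Ay <-]; exact: le_trans (ler_norm _) (hM _ Ay).
Qed.

Lemma Dhat_sqr_le_max x : At x -> D x ^+ 2 <= maxDhat2 Rn S L lam X Y t At.
Proof.
move=> Ax; have [M hM] := ucb_bounded.
apply: ub_le_sup; last by exists x.
exists ((M + M) ^+ 2) => _ [y Ay <-].
have D0 : 0 <= D y by rewrite subr_ge0 ucb_le_sup.
have DM : D y <= M + M.
  apply: lerD; last by have := hM _ Ay; rewrite ler_norml -lerNl => /andP[].
  apply: ge_sup; first by exists (U y); exists y.
  by move=> _ [z Az <-]; exact: le_trans (ler_norm _) (hM _ Az).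
by rewrite lerXn2r ?nnegrE // (le_trans D0).
Qed.

Variable lead : 'rV[R]_d.
Hypotheses (At_lead : At lead) (U_lead : U lead = sup (U @` At)).
Hypothesis At_X : At (X t).
Hypothesis X_min : forall x, At x ->
  (linimed3_index Rn S L lam C X Y t At lead (X t)
   <= linimed3_index Rn S L lam C X Y t At lead x)%E.

(* If the pulled arm is not the leader, comparing its index with
   [ln (C / maxDhat2)] gives [r + ln r <= ln C] for [r := D^2 / g]. *)
Lemma Dhat_pulled : D (X t) ^+ 2 <= Num.max 1 (ln C) * g (X t).
Proof.
have g0 := gidx_ge0 (X t).
have rhs0 : 0 <= Num.max 1 (ln C) * g (X t).
  by rewrite mulr_ge0 // le_max ler01.
have [D0|D0] := eqVneq (D (X t)) 0; first by rewrite D0 expr0n.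
(* The leader attains the supremum of the UCB, so its gap is 0. *)
have Xlead : X t != lead.
  by apply: contra D0 => /eqP ->; rewrite /D /Dhat -/U -U_lead subrr.
have D2 : 0 < D (X t) ^+ 2 by rewrite exprn_even_gt0.
have m0 := lt_le_trans D2 (Dhat_sqr_le_max At_X).
have := X_min At_lead.
rewrite /linimed3_index (negbTE Xlead) eqxx /idx_leader m0 le_min => /andP[+ _].
rewrite /idx_other -/(g (X t)) -/(D (X t)).
(* If [g] vanishes, the pulled arm has index [+oo], which cannot lie below the finite value
   [ln (C / maxDhat2)]. *)
case: ifPn => [g_gt0|_]; last by rewrite leye_eq.
rewrite lee_fin => h.
have C0 : 0 < C := lt_le_trans ltr01 C_ge1.
have {}h : D (X t) ^+ 2 / g (X t) - ln (g (X t)) <= ln C - ln (D (X t) ^+ 2).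
  rewrite (le_trans h) // -ln_div ?posrE // ler_ln ?posrE ?divr_gt0 //.
  by rewrite ler_pM2l // lef_pV2 ?posrE // Dhat_sqr_le_max.
rewrite -ler_pdivrMr // le_max; set r := _ / _ in h *.
have r0 : 0 < r by rewrite divr_gt0.
have rE : ln (D (X t) ^+ 2) = ln r + ln (g (X t)).
  by rewrite -lnM ?posrE // divfK ?gt_eqF.
(* For [r > 1] the term [ln r] is positive, so that [r <= ln C]. *)
have [//|r1] := leP r 1; have := ln_gt0 r1; move: h; rewrite rE /=; lra.
Qed.

(** Optimism: the best true reward is below the largest UCB, which is the gap of the pulled arm plus
    its own UCB; the latter exceeds its true reward by at most two confidence widths. *)
Lemma regret_pulled (theta : 'rV[R]_d) :
  (forall x, `|mu x - dotv theta x| <= Num.sqrt (beta_prev d Rn S L lam t) *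
      Num.sqrt (wnorm2 (invmx (Vmat lam X t.-1)) x)) ->
  sup (dotv theta @` At) - dotv theta (X t) <=
  (Num.sqrt (Num.max 1 (ln C)) + 2) * Num.sqrt (g (X t)).
Proof.
move=> conf.
have m0 : 0 <= Num.max 1 (ln C) by rewrite le_max ler01.
have h1 : sup (dotv theta @` At) <= sup (U @` At).
  apply: ge_sup; first by exists (dotv theta lead); exists lead.
  move=> _ [x Ax <-]; apply: le_trans (ucb_le_sup Ax).
  have := conf x; rewrite ler_distl => /andP[h _].
  by move: h; rewrite /U /ucb -/mu; lra.
have h2 : D (X t) <= Num.sqrt (Num.max 1 (ln C)) * Num.sqrt (g (X t)).
  rewrite -sqrtrM // (le_trans (ler_norm _)) // -sqrtr_sqr ler_wsqrtr //.
  exact: Dhat_pulled.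
have := conf (X t); rewrite ler_distl gidx_sqrt => /andP[_ h].
have DE : D (X t) = sup (U @` At) - (mu (X t) + Num.sqrt (g (X t))).
  by rewrite -gidx_sqrt.
by move: h1 h2 h; rewrite DE; lra.
Qed.

Lemma regret_ge0 (theta : 'rV[R]_d) :
  0 <= sup (dotv theta @` At) - dotv theta (X t).
Proof.
rewrite subr_ge0; apply: ub_le_sup; last by exists (X t).
exists (enorm theta * L) => _ [x Ax <-].
exact: le_trans (ler_norm _) (dotv_bounded _ Ax).
Qed.

End Round.

(** * Summation over the rounds *)

Section LogBounds.
Variable R : realType.

(** This is ln (1 + z) <= z at z = - x / (1 + x), where 1 + z is the inverse of 1 + x. *)
Lemma ln_ge_frac (x : R) : 0 <= x -> x / (1 + x) <= ln (1 + x).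
Proof.
move=> x0; have x1 : 0 < 1 + x by rewrite ltr_pwDl.
have h : -1 < - (x / (1 + x)).
  by rewrite ltrN2 ltr_pdivrMr // mul1r ltrDr.
have := le_ln1Dx h.
have -> : 1 - x / (1 + x) = (1 + x)^-1 by field; rewrite gt_eqF.
by rewrite lnV ?posrE // lerN2.
Qed.

Lemma min1_le_ln (x : R) : 0 <= x -> Num.min 1 x <= 2 * ln (1 + x).
Proof.
move=> x0; have x1 : 0 < 1 + x by rewrite ltr_pwDl.
apply: le_trans (ler_wpM2l _ (ln_ge_frac x0)) => //.
rewrite mulrA ler_pdivlMr //.
by have [h|h] := leP x 1; rewrite ?mul1r //; nra.
Qed.

(** [ln_ge_frac] at 1 / (n + 1) says that 1 / (n + 2) <= ln (n + 2) - ln (n + 1), and the right-hand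
    sides telescope. *)
Lemma harmonic_le (n : nat) :
  \sum_(1 <= t < n.+2) (t%:R : R)^-1 <= 1 + ln n.+1%:R.
Proof.
elim: n => [|n IH]; first by rewrite big_nat1 invr1 ln1 addr0.
rewrite big_nat_recr //= (le_trans (lerD IH (lexx _))) // -addrA lerD2l.
have n0 : 0 < (n.+1%:R : R) by rewrite ltr0n.
have := @ln_ge_frac n.+1%:R^-1; rewrite invr_ge0 ltW // => /(_ isT).
have -> : 1 + n.+1%:R^-1 = n.+2%:R / n.+1%:R :> R.
  by rewrite -[n.+2%:R]natr1; field; rewrite gt_eqF.
rewrite ln_div ?posrE ?ltr0n // lerBrDl; congr (_ <= _); congr (_ + _).
by field; rewrite !gt_eqF // ?ltr0n.
Qed.

End LogBounds.

(* [m <= m^2 / (2 z) + z / 2] with [z = B / sqrt T]. *)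
Lemma sum_le_sqrt (R : realType) (T : nat) (m : nat -> R) (B : R) : 0 < B ->
  \sum_(1 <= t < T.+1) m t ^+ 2 <= B ^+ 2 ->
  \sum_(1 <= t < T.+1) m t <= B * Num.sqrt T%:R.
Proof.
move=> B0 hB; case: T hB => [|T] hB; first by rewrite big_geq // sqrtr0 mulr0.
set s := Num.sqrt _; have s0 : 0 < s by rewrite sqrtr_gt0 ltr0n.
have sT : s ^+ 2 = T.+1%:R by rewrite sqr_sqrtr.
pose z := B / s; have z0 : 0 < z by rewrite divr_gt0.
apply: (@le_trans _ _ (\sum_(1 <= t < T.+2) ((2 * z)^-1 * m t ^+ 2 + z / 2))).
  apply: ler_sum => t _; rewrite -subr_ge0.
  have -> : (2 * z)^-1 * m t ^+ 2 + z / 2 - m t = (m t - z) ^+ 2 / (2 * z).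
    by field; rewrite gt_eqF.
  by rewrite divr_ge0 ?sqr_ge0 // mulr_ge0 // ltW.
rewrite big_split /= -mulr_sumr big_const_nat iter_addr addr0 subSS subn0.
rewrite -[(z / 2) *+ _]mulr_natr -sT.
apply: (@le_trans _ _ ((2 * z)^-1 * B ^+ 2 + z / 2 * s ^+ 2)).
  by rewrite lerD2r ler_pM2l // invr_gt0 mulr_gt0.
rewrite le_eqVlt; apply/orP; left; apply/eqP; rewrite /z.
by field; rewrite !gt_eqF.
Qed.

(** * Elliptical potential bound and the sum of the confidence widths *)

Section Summation.
Variables (R : realType) (d T : nat) (Rn S L lam : R) (X : nat -> 'rV[R]_d).
Hypotheses (Rn_ge0 : 0 <= Rn) (lam_gt0 : 0 < lam).
Hypotheses (lamS : 1 <= Num.sqrt lam * S).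
Hypotheses (d_gt0 : (0 < d)%N) (T_ge2 : (2 <= T)%N).
Hypothesis X_le : forall s, (1 <= s <= T)%N -> dotv (X s) (X s) <= L ^+ 2.

(** For T >= 2 a constant is absorbed in a multiple of ln T through division by ln 2. The 3 counts
    the powers of T in T (1 + L^2 / lam) T^2, which dominates the argument of the logarithm in
    beta. *)
Definition log_coef (L lam : R) : R := ln (1 + L ^+ 2 / lam) / ln 2 + 3.

(** The coefficient that (a + b)^2 <= 2 a^2 + 2 b^2 yields for beta, with the constant term absorbed
    in ln T as above. *)
Definition beta_coef (Rn S L lam : R) : R :=
  2 * Rn ^+ 2 * log_coef L lam + 2 * (Num.sqrt lam * S) ^+ 2 / ln 2.

Lemma ln2_gt0 : 0 < ln (2 : R).
Proof. by rewrite ln_gt0 // ltr1n. Qed.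

Let Lq : R := L ^+ 2 / lam.
Let Lq0 : 0 <= Lq. Proof. by rewrite divr_ge0 ?sqr_ge0 ?ltW. Qed.

Let T_gt0 : 0 < (T%:R : R). Proof. by rewrite ltr0n (leq_trans _ T_ge2). Qed.

Lemma ln2_leT : ln 2 <= ln (T%:R : R).
Proof. by rewrite ler_ln ?posrE ?ler_nat. Qed.

Lemma ln_horizon_le :
  ln (1 + Lq) + 3 * ln T%:R <= log_coef L lam * ln T%:R.
Proof.
rewrite /log_coef -/Lq [(_ + 3) * _]mulrDl lerD2r mulrAC ler_pdivlMr ?ln2_gt0 //.
by rewrite ler_wpM2l ?ln2_leT // ln_ge0 // lerDl.
Qed.

Lemma log_coef_ge3 : 3 <= log_coef L lam.
Proof. by rewrite lerDr divr_ge0 ?ln_ge0 ?lerDl // ltW // ln2_gt0. Qed.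

Let lin_le t : (t <= T)%N -> 1 + t%:R * L ^+ 2 / lam <= T%:R * (1 + Lq).
Proof.
move=> tT; rewrite mulrDr mulr1 lerD //; first by rewrite ler1n (leq_trans _ T_ge2).
by rewrite -mulrA -/Lq ler_wpM2r // ler_nat.
Qed.

Let lin_ge1 t : 1 <= 1 + t%:R * L ^+ 2 / lam.
Proof. by rewrite lerDl -mulrA mulr_ge0. Qed.

Lemma ln_growth_le t : (t <= T)%N ->
  ln (1 + t%:R * L ^+ 2 / lam) <= log_coef L lam * ln T%:R.
Proof.
move=> tT; apply: le_trans ln_horizon_le.
have L1 : 0 < 1 + Lq by rewrite ltr_pwDl.
apply: (@le_trans _ _ (ln (T%:R * (1 + Lq)))).
  rewrite ler_ln ?posrE ?lin_le ?mulr_gt0 //.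
  exact: lt_le_trans ltr01 (lin_ge1 _).
rewrite lnM ?posrE //; have := ln2_leT; have := ln2_gt0; lra.
Qed.

Lemma ln_confidence_le t : (1 <= t <= T)%N ->
  0 <= ln ((1 + t.-1%:R * L ^+ 2 / lam) / (t%:R ^+ 2)^-1)
    <= log_coef L lam * ln T%:R.
Proof.
move=> /andP[t1 tT]; rewrite invrK.
have tr : 1 <= (t%:R : R) by rewrite ler1n.
have L1 : 0 < 1 + Lq by rewrite ltr_pwDl.
apply/andP; split; first by rewrite ln_ge0 // mulr_ege1 ?exprn_ege1.
apply: le_trans ln_horizon_le.
apply: (@le_trans _ _ (ln ((T%:R * (1 + Lq)) * T%:R ^+ 2))).
  have t0 : 0 < (t%:R : R) := lt_le_trans ltr01 tr.
  have w0 : 0 < 1 + t.-1%:R * L ^+ 2 / lam := lt_le_trans ltr01 (lin_ge1 _).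
  rewrite ler_ln ?posrE ?mulr_gt0 ?exprn_gt0 //.
  apply: ler_pM; rewrite ?exprn_ge0 ?(ltW w0) //.
    exact: lin_le (leq_trans (leq_pred t) tT).
  by rewrite lerXn2r ?nnegrE ?ler_nat.
by rewrite !lnM ?lnXn ?posrE ?mulr_gt0 ?exprn_gt0 //; lra.
Qed.

Lemma beta_prev_le t : (1 <= t <= T)%N ->
  beta_prev d Rn S L lam t <= beta_coef Rn S L lam * (d%:R * ln T%:R).
Proof.
move=> tT; have /andP[l0 l1] := ln_confidence_le tT.
rewrite /beta_prev /beta_coef; set l := ln _ in l0 l1 *.
set b := Num.sqrt lam * S.
have d1 : 1 <= (d%:R : R) by rewrite ler1n.
have a2 : (Rn * Num.sqrt (d%:R * l)) ^+ 2 <=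
    Rn ^+ 2 * (log_coef L lam * (d%:R * ln T%:R)).
  rewrite exprMn sqr_sqrtr ?mulr_ge0 // ler_wpM2l ?sqr_ge0 // mulrCA.
  by rewrite ler_wpM2l.
have b2 : b ^+ 2 <= b ^+ 2 / ln 2 * (d%:R * ln T%:R).
  rewrite -mulrA ler_peMr ?sqr_ge0 // mulrC ler_pdivlMr ?ln2_gt0 // mul1r.
  by rewrite (le_trans ln2_leT) // ler_peMl // (le_trans (ltW ln2_gt0) ln2_leT).
move: a2 b2; set a := Rn * Num.sqrt _ => a2 b2.
set D := _ * ln T%:R in a2 b2 *.
have -> : (2 * Rn ^+ 2 * log_coef L lam + 2 * b ^+ 2 / ln 2) * D =
    2 * (Rn ^+ 2 * (log_coef L lam * D)) + 2 * (b ^+ 2 / ln 2 * D) by ring.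
by have := sqr_ge0 (a - b); nra.
Qed.

(** The elliptical potential argument: each capped width is at most 2 ln (1 + u_t), and these
    logarithms add up to the logarithm of [potential]. *)
Lemma sum_width_le :
  \sum_(1 <= t < T.+1) Num.min 1 (width lam X t)
  <= 2 * (d%:R * (log_coef L lam * ln T%:R)).
Proof.
apply: (@le_trans _ _ (2 * ln (potential lam X T))).
  rewrite /potential; elim: {1 2}T => [|n IH].
    by rewrite !big_geq // ln1 mulr0.
  rewrite big_nat_recr //= [X in ln X]big_nat_recr //= lnM ?posrE ?mulrDr.
  - by rewrite lerD // min1_le_ln // width_ge0.
  - exact: lt_le_trans ltr01 (potential_ge1 lam_gt0 X n).
  - by rewrite ltr_pwDl // width_ge0.
rewrite ler_pM2l //.
apply: (@le_trans _ _ (ln ((1 + T%:R * L ^+ 2 / lam) ^+ d))).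
  rewrite ler_ln ?posrE ?exprn_gt0 ?potential_le //.
  - exact: lt_le_trans ltr01 (potential_ge1 lam_gt0 X T).
  - exact: lt_le_trans ltr01 (lin_ge1 _).
rewrite lnXn; last exact: lt_le_trans ltr01 (lin_ge1 _).
by rewrite -[ln _ *+ d]mulr_natl ler_wpM2l // ln_growth_le.
Qed.

Definition sum_coef (c Rn S L lam : R) : R :=
  Num.sqrt (2 * (c ^+ 2 * beta_coef Rn S L lam * log_coef L lam)).

(** By [sum_le_sqrt] it is enough to bound the sum of squares. One factor d ln T comes from beta and
    another from the sum of the widths, so the root contributes d ln T. *)
Lemma sum_gidx_le (c : R) : 1 <= c ->
  \sum_(1 <= t < T.+1) Num.min 1 (c * Num.sqrt (gidx Rn S L lam X t (X t)))
  <= sum_coef c Rn S L lam * (d%:R * ln T%:R) * Num.sqrt T%:R.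
Proof.
move=> c1; set b := beta_coef Rn S L lam; set l := log_coef L lam.
have D0 : 0 < d%:R * ln T%:R :> R.
  by rewrite mulr_gt0 ?ltr0n // (lt_le_trans ln2_gt0 ln2_leT).
have l0 : 0 < l by rewrite (lt_le_trans _ log_coef_ge3).
have bD : 1 <= b * (d%:R * ln T%:R).
  have T1 : (1 <= 1 <= T)%N by rewrite (leq_trans _ T_ge2).
  exact: le_trans (beta_prev_ge1 d L 1 Rn_ge0 lamS) (beta_prev_le T1).
have b0 : 0 < b by rewrite -(pmulr_lgt0 _ D0) (lt_le_trans ltr01).
have c0 : 0 < c := lt_le_trans ltr01 c1.
have r0 : 0 < 2 * (c ^+ 2 * b * l) by rewrite !mulr_gt0.
apply: sum_le_sqrt; first by rewrite mulr_gt0 // sqrtr_gt0.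
rewrite exprMn sqr_sqrtr ?(ltW r0) //.
apply: (@le_trans _ _ (\sum_(1 <= t < T.+1)
   (c ^+ 2 * (b * (d%:R * ln T%:R))) * Num.min 1 (width lam X t))).
  apply: ler_sum_nat => t /andP[t1 tT]; rewrite ltnS in tT.
  have w0 := width_ge0 lam_gt0 X t.
  have be1 := beta_prev_ge1 d L t Rn_ge0 lamS.
  have be2 : beta_prev d Rn S L lam t <= b * (d%:R * ln T%:R).
    by apply: beta_prev_le; rewrite t1 tT.
  have cq : 1 <= c ^+ 2 by rewrite exprn_ege1.
  set g := gidx _ _ _ _ _ _ _; have gE : g = beta_prev d Rn S L lam t * width lam X t by [].
  have g0 : 0 <= g by rewrite gE mulr_ge0 // (le_trans ler01).
  have gW : g <= b * (d%:R * ln T%:R) * width lam X t by rewrite gE ler_wpM2r.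
  have m0 : 0 <= Num.min 1 (c * Num.sqrt g).
    by rewrite le_min ler01 mulr_ge0 ?sqrtr_ge0 // ltW.
  have m1 : Num.min 1 (c * Num.sqrt g) <= 1 by rewrite ge_min lexx.
  have m2 : Num.min 1 (c * Num.sqrt g) <= c * Num.sqrt g by rewrite ge_min lexx orbT.
  (* A width above 1 is handled by the cap, since c^2 and the bound on beta are at least 1;
     otherwise the square is at most c^2 g. *)
  have [h|h] := leP 1 (width lam X t).
    rewrite mulr1 (le_trans (_ : _ <= 1)) ?exprn_ile1 //.
    by rewrite mulr_ege1.
  rewrite (le_trans (_ : _ <= (c * Num.sqrt g) ^+ 2)) //.
    by rewrite lerXn2r ?nnegrE // mulr_ge0 ?sqrtr_ge0 // ltW.
  by rewrite exprMn sqr_sqrtr // -mulrA ler_wpM2l ?sqr_ge0.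
rewrite -mulr_sumr.
have h : 0 <= c ^+ 2 * (b * (d%:R * ln T%:R)).
  by rewrite mulr_ge0 ?sqr_ge0 // (le_trans ler01).
rewrite (le_trans (ler_wpM2l h sum_width_le)) // -/l.
rewrite le_eqVlt; apply/orP; left; apply/eqP.
by rewrite -/b; ring.
Qed.

End Summation.

(** * Sub-Gaussian noise with predictable coefficients *)

Section Discretization.
Variable R : realType.
Implicit Types (n : nat) (x : R).

Definition grid n x : nat := Num.trunc (n.+1%:R * Num.max x 0).

Lemma grid_le n x : 0 <= x -> (grid n x)%:R / n.+1%:R <= x.
Proof.
move=> x0; rewrite /grid max_l // ler_pdivrMr ?ltr0n // [x * _]mulrC.
by have /andP[] := @truncn_itv R (n.+1%:R * x) (mulr_ge0 (ler0n _ _) x0).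
Qed.

Lemma grid_neg n x : x <= 0 -> grid n x = 0%N.
Proof. by move=> x0; rewrite /grid max_r // mulr0 truncn0. Qed.

Lemma grid_cvg x : 0 <= x -> (grid n x)%:R / n.+1%:R @[n --> \oo] --> x.
Proof.
move=> x0; apply: (@squeeze_cvgr _ _ _ _ (fun n => x - harmonic n) (fun=> x)).
- near=> n; rewrite grid_le // andbT /harmonic /=.
  have n0 : 0 < (n.+1%:R : R) by rewrite ltr0n.
  rewrite ler_pdivlMr // mulrBl mulVf ?gt_eqF // lerBlDr [x * _]mulrC natr1 ltW //.
  rewrite /grid max_l //.
  by have /andP[] := @truncn_itv R (n.+1%:R * x) (mulr_ge0 (ler0n _ _) x0).
- by rewrite -[X in _ --> X]subr0; apply: cvgB; [exact: cvg_cst|exact: cvg_harmonic].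
- exact: cvg_cst.
Unshelve. all: by end_near. Qed.

(** Rounding towards 0 with step 1 / (n + 1): it takes countably many values and never increases the
    square. *)
Definition sgrid n x : R := (grid n x)%:R / n.+1%:R - (grid n (- x))%:R / n.+1%:R.

Lemma sgrid_sqr_le n x : sgrid n x ^+ 2 <= x ^+ 2.
Proof.
rewrite /sgrid; have [x0|x0] := leP 0 x.
  rewrite (@grid_neg n (- x)) ?oppr_le0 // mul0r subr0.
  by rewrite lerXn2r ?nnegrE ?divr_ge0 ?grid_le.
rewrite (@grid_neg n x) ?(ltW x0) // mul0r sub0r sqrrN -[x ^+ 2]sqrrN.
by rewrite lerXn2r ?nnegrE ?divr_ge0 ?grid_le ?oppr_ge0 // ltW.
Qed.

Lemma sgrid_cvg x : sgrid n x @[n --> \oo] --> x.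
Proof.
rewrite /sgrid; have [x0|x0] := leP 0 x.
  under eq_fun do rewrite (@grid_neg _ (- x)) ?oppr_le0 // mul0r subr0.
  exact: grid_cvg.
under eq_fun do rewrite (@grid_neg _ x) ?(ltW x0) // mul0r sub0r.
have x0' : 0 <= - x by rewrite oppr_ge0 ltW.
have := cvgN (grid_cvg x0'); rewrite opprK; exact.
Qed.

Lemma measurable_grid d (T : measurableType d) n (f : T -> R) :
  measurable_fun setT f -> forall k, measurable ((fun w => grid n (f w)) @^-1` [set k]).
Proof.
move=> mf k.
have m1 : measurable_fun setT (fun w => (grid n (f w))%:R : R).
  rewrite (_ : (fun w => _) = (fun x => (grid n x)%:R : R) \o f) //.
  apply: measurableT_comp => //; apply: nondecreasing_measurable => // x y xy.
  rewrite ler_nat /grid le_truncn // ler_pM2l ?ltr0n //.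
  by rewrite ge_max !le_max xy lexx !orbT.
rewrite (_ : _ @^-1` _ = [set: T] `&` (fun w => (grid n (f w))%:R : R) @^-1` [set k%:R]).
  exact: m1.
rewrite setTI; apply/seteqP; split=> w /= => [->//|/eqP].
by rewrite eqr_nat => /eqP.
Qed.

End Discretization.

Lemma measurable_comp_nat d (T : measurableType d) (R : realType)
    (D : T -> nat) (h : nat -> R) :
  (forall k, measurable (D @^-1` [set k])) ->
  measurable_fun setT (fun x => h (D x)).
Proof.
move=> mD _ B mB; rewrite setTI.
rewrite (_ : _ @^-1` _ = \bigcup_(k in h @^-1` B) (D @^-1` [set k])).
  by apply: bigcup_measurable => k _.
by apply/seteqP; split=> [x /= hx|x [k hk /= Dk]]; [exists (D x)|rewrite /= Dk].
Qed.

Lemma limn_einf_le (R : realType) (u : (\bar R)^nat) (M : \bar R) :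
  (forall n, (u n <= M)%E) -> (limn_einf u <= M)%E.
Proof.
move=> uM; rewrite limn_einf_lim; apply: lime_le; first exact: is_cvg_einfs.
by near=> n; rewrite (le_trans _ (uM n)) //; apply: ereal_inf_lbound; exists n => /=.
Unshelve. all: by end_near. Qed.

Section SubGaussian.
Variables (dsp : measure_display) (Omega : measurableType dsp) (R : realType).
Variables (P : probability Omega R) (gen : set (set Omega)) (eta : Omega -> R).
Variable Rn : R.
Hypothesis gen_measurable : gen `<=` measurable.
Hypothesis meas_eta : measurable_fun setT eta.
Hypothesis subgauss : forall (l : R) (G : set Omega), <<s gen >> G ->
  (\int[P]_(w in G) (expR (l * eta w))%:E
   <= (expR (l ^+ 2 * Rn ^+ 2 / 2))%:E * P G)%E.

Local Notation F := (g_sigma_algebraType gen).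

Lemma sub_measurable (G : set Omega) :
  measurable (G : set F) -> measurable (G : set Omega).
Proof. exact: (smallest_sub (sigma_algebra_measurable Omega) gen_measurable). Qed.

Lemma sub_measurable_fun (f : Omega -> R) :
  measurable_fun (setT : set F) f -> measurable_fun (setT : set Omega) f.
Proof.
move=> mf _ B mB; apply: sub_measurable; exact: mf.
Qed.

(** On each level set of [D], an event of the past, the coefficients are constants and [subgauss]
    applies with this set as [G]; the countably many pieces are then added. *)
Lemma subgauss_discrete (D : Omega -> nat) (w l : nat -> R) :
  (forall k, measurable (D @^-1` [set k] : set F)) -> (forall k, 0 <= w k) ->
  (\int[P]_x (w (D x) * expR (l (D x) * eta x))%:E <=
   \int[P]_x (w (D x) * expR (l (D x) ^+ 2 * Rn ^+ 2 / 2))%:E)%E.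
Proof.
move=> mD w0.
have mD' k : measurable (D @^-1` [set k]) by exact: sub_measurable (mD k).
have mDf (h : nat -> R) : measurable_fun setT (fun x => h (D x)).
  exact: measurable_comp_nat.
have cover : [set: Omega] = \bigcup_k (D @^-1` [set k]).
  by apply/seteqP; split=> // x _; exists (D x).
have triv : trivIset [set: nat] (fun k => D @^-1` [set k]).
  exact: trivIset_preimage1.
have mL k : measurable_fun setT (fun x => (expR (l k * eta x))%:E).
  by apply/measurable_EFinP; apply: measurableT_comp => //; exact: measurable_funM.
have mlhs : measurable_fun setT (fun x => (w (D x) * expR (l (D x) * eta x))%:E).
  apply/measurable_EFinP; apply: measurable_funM; first exact: (mDf w).
  apply: measurableT_comp => //; apply: measurable_funM => //; exact: (mDf l).
have mrhs : measurable_fun setT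
    (fun x => (w (D x) * expR (l (D x) ^+ 2 * Rn ^+ 2 / 2))%:E).
  by apply/measurable_EFinP; exact: (mDf (fun k => w k * expR (l k ^+ 2 * Rn ^+ 2 / 2))).
have split_int (f : Omega -> \bar R) : measurable_fun setT f ->
    (forall x, (0 <= f x)%E) ->
    (\int[P]_x f x = \sum_(0 <= k <oo) \int[P]_(x in D @^-1` [set k]) f x)%E.
  move=> mf f0; rewrite cover; apply: ge0_integral_bigcup => //.
  by rewrite -cover.
have lhs0 x : (0 <= (w (D x) * expR (l (D x) * eta x))%:E)%E.
  by rewrite lee_fin mulr_ge0 ?expR_ge0.
have rhs0 x : (0 <= (w (D x) * expR (l (D x) ^+ 2 * Rn ^+ 2 / 2))%:E)%E.
  by rewrite lee_fin mulr_ge0 ?expR_ge0.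
rewrite (split_int _ mlhs lhs0) (split_int _ mrhs rhs0).
apply: lee_nneseries => k _.
  by move=> _; exact: integral_ge0.
rewrite [leLHS](_ : _ =
    (\int[P]_(x in D @^-1` [set k]) ((w k)%:E * (expR (l k * eta x))%:E))%E); last first.
  by apply: eq_integral => x; rewrite inE /= => ->; rewrite EFinM.
rewrite [leRHS](_ : _ = (\int[P]_(x in D @^-1` [set k])
    cst (w k * expR (l k ^+ 2 * Rn ^+ 2 / 2))%:E x)%E); last first.
  by apply: eq_integral => x; rewrite inE /= => ->.
have mLk : measurable_fun (D @^-1` [set k]) (fun x => (expR (l k * eta x))%:E).
  exact: measurable_funS (mL k).
rewrite integral_cst // ge0_integralZl_EFin //.
by rewrite EFinM -muleA lee_wpmul2l ?lee_fin //; exact: subgauss (mD k).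
Qed.

(** The coefficients are rounded to a grid. Rounding increases neither [w] nor the square of [l], so
    the right-hand side dominates uniformly in the mesh, and Fatou's lemma passes to the limit on
    the left. *)
Lemma subgauss_integral (w l : Omega -> R) :
  measurable_fun (setT : set F) w -> measurable_fun (setT : set F) l ->
  (forall x, 0 <= w x) ->
  (\int[P]_x (w x * expR (l x * eta x))%:E <=
   \int[P]_x (w x * expR (l x ^+ 2 * Rn ^+ 2 / 2))%:E)%E.
Proof.
move=> mw ml w0.
(* The three rounded values are coded by a single integer. *)
pose D n x := pickle (grid n (w x), (grid n (l x), grid n (- l x))).
pose dec (k : nat) : nat * (nat * nat) := odflt (0, (0, 0))%N (unpickle k).
pose wn n k : R := (dec k).1%:R / n.+1%:R.
(* Within this proof [ln] is the rounded slope, not the logarithm. *)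
pose ln n k : R := (dec k).2.1%:R / n.+1%:R - (dec k).2.2%:R / n.+1%:R.
have decD n x : dec (D n x) = (grid n (w x), (grid n (l x), grid n (- l x))).
  by rewrite /dec /D pickleK.
have mD n k : measurable (D n @^-1` [set k] : set F).
  (* An integer that is not a code is decoded to some other value; the test discards it, as its
     level set is empty. *)
  rewrite (_ : _ @^-1` _ = if pickle (dec k) == k then
      (fun x => grid n (w x)) @^-1` [set (dec k).1] `&`
      ((fun x => grid n (l x)) @^-1` [set (dec k).2.1] `&`
       (fun x => grid n (- l x)) @^-1` [set (dec k).2.2]) else set0).
    case: ifP => _; last exact: measurable0.
    apply: measurableI; first exact: measurable_grid.
    by apply: measurableI; apply: measurable_grid => //; exact: measurable_funN.
  apply/seteqP; split=> x /=.
    by move=> Dk; rewrite -Dk decD /= eqxx.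
  case: ifP => // /eqP dk /= [e1 [e2 e3]].
  by rewrite -dk /D e1 e2 e3; case: (dec k) => ? [? ?].
have lnD n x : ln n (D n x) = sgrid n (l x) by rewrite /ln decD.
have mDf n (h : nat -> R) : measurable_fun setT (fun x => h (D n x)).
  by apply: measurable_comp_nat => k; exact: sub_measurable (mD n k).
have {}ml := sub_measurable_fun ml; have {}mw := sub_measurable_fun mw.
have h n : (\int[P]_x (wn n (D n x) * expR (ln n (D n x) * eta x))%:E <=
    \int[P]_x (w x * expR (l x ^+ 2 * Rn ^+ 2 / 2))%:E)%E.
  apply: le_trans (subgauss_discrete (ln n) (mD n) _) _.
    by move=> k; rewrite divr_ge0.
  apply: ge0_le_integral => //.
  - by move=> x _; rewrite lee_fin mulr_ge0 ?expR_ge0 ?divr_ge0.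
  - apply/measurable_EFinP.
    exact: (mDf n (fun k => wn n k * expR (ln n k ^+ 2 * Rn ^+ 2 / 2))).
  - apply/measurable_EFinP; apply: measurable_funM => //.
    apply: measurableT_comp => //; apply: measurable_funM => //.
    by apply: measurable_funM => //; exact: measurable_funX.
  move=> x _; rewrite lee_fin ler_pM ?expR_ge0 ?divr_ge0 //.
    by rewrite /wn decD grid_le.
  by rewrite ler_expR ler_pM2r // ler_wpM2r ?sqr_ge0 // lnD sgrid_sqr_le.
apply: le_trans (limn_einf_le h).
rewrite (eq_integral (fun x =>
    limn_einf (fun n => (wn n (D n x) * expR (ln n (D n x) * eta x))%:E))); last first.
  move=> x _; apply/esym/(cvg_limn_einf_sup _).1.
  apply: cvg_EFin; first by near=> n.
  rewrite /comp /=; apply: cvgM.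
    by under eq_fun do rewrite /wn decD; exact: grid_cvg.
  apply: continuous_cvg; first exact: continuous_expR.
  by apply: cvgMl; under eq_fun do rewrite lnD; exact: sgrid_cvg.
apply: fatou => // n.
- apply/measurable_EFinP; apply: measurable_funM; first exact: (mDf n (wn n)).
  by apply: measurableT_comp => //; apply: measurable_funM.
- by move=> x _; rewrite lee_fin mulr_ge0 ?expR_ge0 ?divr_ge0.
Unshelve. all: by end_near. Qed.

End SubGaussian.

(** * Gaussian mixture *)

Section Gaussian.
Variable R : realType.

(** Reduces a Gaussian integral to a pointwise identity, obtained in each use by completing the
    square. *)
Lemma integral_scaled_normal_pdf (f : R -> R) (c m s : R) : 0 <= c ->
  (forall x, f x = c * normal_pdf m s x) ->
  (\int[lebesgue_measure]_x (f x)%:E = c%:E)%E.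
Proof.
move=> c0 fE; under eq_integral do rewrite fE EFinM.
rewrite ge0_integralZl_EFin ?integral_normal_pdf ?mule1 //.
- by move=> x _; rewrite lee_fin normal_pdf_ge0.
- by apply/measurable_EFinP; exact: measurable_normal_pdf.
Qed.

Lemma gauss_mgf (b : R) :
  (\int[lebesgue_measure]_x (normal_pdf 0 1 x * expR (b * x))%:E =
   (expR (b ^+ 2 / 2))%:E)%E.
Proof.
apply: (@integral_scaled_normal_pdf _ _ b 1); first exact: expR_ge0.
move=> x; rewrite !normal_pdfE ?oner_eq0 // /normal_fun -mulrA -expRD.
by rewrite [RHS]mulrCA -expRD; congr (_ * expR _); rewrite expr1n; field.
Qed.

(** With p^2 = (v - 1) / v the total coefficient of x^2 is - 1 / (2 v), so the integrand is a
    multiple of the normal density of mean v p q and variance v. *)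
Lemma gauss_quadratic (v q : R) : 1 <= v ->
  (\int[lebesgue_measure]_x
     (normal_pdf 0 1 x * expR ((Num.sqrt ((v - 1) / v) * x + q) ^+ 2 / 2))%:E =
   (Num.sqrt v * expR (v * q ^+ 2 / 2))%:E)%E.
Proof.
move=> v1; have v0 : 0 < v := lt_le_trans ltr01 v1.
set p := Num.sqrt _; have p2 : p ^+ 2 = (v - 1) / v.
  by rewrite sqr_sqrtr // divr_ge0 ?subr_ge0 // ltW.
have s0 : 0 < Num.sqrt v by rewrite sqrtr_gt0.
have s2 : Num.sqrt v ^+ 2 = v by rewrite sqr_sqrtr // ltW.
apply: (@integral_scaled_normal_pdf _ _ (v * p * q) (Num.sqrt v)).
  by rewrite mulr_ge0 ?expR_ge0 // ltW.
move=> x; rewrite !normal_pdfE ?oner_eq0 ?gt_eqF // /normal_fun /normal_peak s2.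
rewrite expr1n mul1r -[v * pi *+ 2]mulrnAr sqrtrM ?(ltW v0) //.
set k := Num.sqrt (pi *+ 2); have k0 : k != 0.
  by rewrite gt_eqF // sqrtr_gt0 pmulrn_lgt0 // pi_gt0.
have -> : (Num.sqrt v * k)^-1 = k^-1 / Num.sqrt v by rewrite invfM mulrC.
rewrite -[LHS]mulrA -expRD.
rewrite [RHS](_ : _ = k^-1 * (expR (v * q ^+ 2 / 2) *
    expR (- (x - v * p * q) ^+ 2 / (v *+ 2)))); last by field; rewrite k0 gt_eqF.
rewrite -expRD; congr (_ * expR _).
have -> : - (x - v * p * q) ^+ 2 / (v *+ 2) =
  - (x ^+ 2 - 2 * v * p * q * x + v ^+ 2 * p ^+ 2 * q ^+ 2) / (v *+ 2).
  by congr (_ / _); ring.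
have -> : (p * x + q) ^+ 2 = p ^+ 2 * x ^+ 2 + 2 * p * q * x + q ^+ 2 by ring.
by rewrite p2; field; rewrite gt_eqF.
Qed.

Lemma measurable_fun_sqrt d (T : measurableType d) (f : T -> R) :
  measurable_fun setT f -> measurable_fun setT (fun x => Num.sqrt (f x)).
Proof.
move=> mf; apply: (measurableT_comp _ mf).
exact: continuous_measurable_fun (@sqrt_continuous R).
Qed.

Lemma measurable_fun_inv d (T : measurableType d) (f : T -> R) :
  (forall x, 0 < f x) ->
  measurable_fun setT f -> measurable_fun setT (fun x => (f x)^-1).
Proof.
move=> f0 mf; rewrite (_ : (fun x => _) = (fun y => y `^ (- 1)) \o f).
  exact: measurableT_comp (measurable_powR _) mf.
by apply/funext => x /=; rewrite powRN powRr1 // ltW.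
Qed.

End Gaussian.

Section MixtureStep.
Variables (dsp : measure_display) (Omega : measurableType dsp) (R : realType).
Variables (P : probability Omega R) (gen : set (set Omega)) (eta : Omega -> R).
Variable Rn : R.
Hypothesis gen_measurable : gen `<=` measurable.
Hypothesis meas_eta : measurable_fun setT eta.
Hypothesis subgauss : forall (l : R) (G : set Omega), <<s gen >> G ->
  (\int[P]_(w in G) (expR (l * eta w))%:E
   <= (expR (l ^+ 2 * Rn ^+ 2 / 2))%:E * P G)%E.

Local Notation F := (g_sigma_algebraType gen).

(* Writing [exp (s eta^2 / 2)] as a Gaussian average of [exp (sqrt s eta y)]
   makes the exponent linear in [eta], so that the sub-Gaussian bound applies
   for each fixed [y]. *)
Lemma mixture_step (kap : R) (a u w : Omega -> R) :
  0 < kap -> kap * Rn ^+ 2 <= 1 ->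
  measurable_fun (setT : set F) a -> measurable_fun (setT : set F) u ->
  measurable_fun (setT : set F) w ->
  (forall x, 0 <= u x) -> (forall x, 0 <= w x) ->
  (\int[P]_x (w x * expR (kap * ((2 * eta x * a x + eta x ^+ 2 * u x - a x ^+ 2)
     / (1 + u x)) / 2))%:E <= \int[P]_x (w x * Num.sqrt (1 + u x))%:E)%E.
Proof.
move=> kap0 kapRn ma mu mw u0 w0.
pose v x := 1 + u x.
have v1 x : 1 <= v x by rewrite lerDl.
have v0 x : 0 < v x := lt_le_trans ltr01 (v1 x).
(* The exponent on the left is A eta + B^2 eta^2 / 2 minus kap a^2 / (2 v); the last term does not
   involve [eta] and is put into the weight. *)
pose w' x := w x * expR (- (kap * a x ^+ 2 * (v x)^-1 / 2)).
pose A x := kap * a x * (v x)^-1.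
pose B x := Num.sqrt (kap * u x * (v x)^-1).
pose phi := @normal_pdf R 0 1.
have w'0 x : 0 <= w' x by rewrite mulr_ge0 ?expR_ge0.
have phi0 y : 0 <= phi y by exact: normal_pdf_ge0.
have mv : measurable_fun (setT : set F) v by exact: measurable_funD.
have miv : measurable_fun (setT : set F) (fun x => (v x)^-1).
  exact: measurable_fun_inv.
have mA : measurable_fun (setT : set F) A.
  by apply: measurable_funM => //; exact: measurable_funM.
have mB : measurable_fun (setT : set F) B.
  by apply: measurable_fun_sqrt; apply: measurable_funM => //; exact: measurable_funM.
have mw' : measurable_fun (setT : set F) w'.
  apply: measurable_funM => //; apply: measurableT_comp => //.
  apply: measurable_funN; apply: measurable_funM => //; apply: measurable_funM => //.
  by apply: measurable_funM => //; exact: measurable_funX.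
pose f (z : Omega * measurableTypeR R) :=
  (phi z.2 * w' z.1 * expR ((B z.1 * z.2 + A z.1) * eta z.1))%:E.
pose g (z : Omega * measurableTypeR R) :=
  (phi z.2 * w' z.1 * expR ((B z.1 * z.2 + A z.1) ^+ 2 / kap / 2))%:E.
have mfst (h : Omega -> R) : measurable_fun setT h ->
    measurable_fun setT (fun z : Omega * measurableTypeR R => h z.1).
  by move=> mh; exact: measurableT_comp mh measurable_fst.
have msnd : measurable_fun setT (fun z : Omega * measurableTypeR R => (z.2 : R)).
  exact: measurable_snd.
have mpw : measurable_fun setT
    (fun z : Omega * measurableTypeR R => phi z.2 * w' z.1).
  apply: measurable_funM.
    exact: measurableT_comp (measurable_normal_pdf 0 1) msnd.
  exact: mfst (sub_measurable_fun gen_measurable mw').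
have ml : measurable_fun setT
    (fun z : Omega * measurableTypeR R => B z.1 * z.2 + A z.1).
  apply: measurable_funD; last exact: mfst (sub_measurable_fun gen_measurable mA).
  apply: measurable_funM => //; exact: mfst (sub_measurable_fun gen_measurable mB).
have mf : measurable_fun setT f.
  apply/measurable_EFinP; apply: measurable_funM => //.
  by apply: measurableT_comp => //; apply: measurable_funM => //; exact: mfst.
have mg : measurable_fun setT g.
  apply/measurable_EFinP; apply: measurable_funM => //.
  apply: measurableT_comp => //; apply: measurable_funM => //.
  by apply: measurable_funM => //; exact: measurable_funX.
have f0 z : (0 <= f z)%E by rewrite lee_fin !mulr_ge0 ?expR_ge0.
have g0 z : (0 <= g z)%E by rewrite lee_fin !mulr_ge0 ?expR_ge0.
have B2 x : B x ^+ 2 = kap * u x * (v x)^-1.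
  by rewrite sqr_sqrtr // !mulr_ge0 ?invr_ge0 // ltW.
have fE x : (\int[lebesgue_measure]_y f (x, y) =
    (w x * expR (kap * ((2 * eta x * a x + eta x ^+ 2 * u x - a x ^+ 2)
      / (1 + u x)) / 2))%:E)%E.
  transitivity ((w' x * expR (A x * eta x))%:E * \int[lebesgue_measure]_y
      (phi y * expR (B x * eta x * y))%:E)%E.
    rewrite -ge0_integralZl_EFin ?mulr_ge0 ?expR_ge0 //.
    - apply: eq_integral => y _; rewrite /f /= -EFinM mulrDl expRD.
      by rewrite [B x * y * _]mulrAC; congr (_%:E); ring.
    - by move=> y _; rewrite lee_fin mulr_ge0 ?expR_ge0.
    - apply/measurable_EFinP; apply: measurable_funM; first exact: measurable_normal_pdf.
      by apply: measurableT_comp => //; exact: measurable_funM.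
  rewrite gauss_mgf -EFinM /w' -(mulrA (w x)) -expRD -(mulrA (w x)) -expRD.
  congr ((_ * expR _)%:E).
  by rewrite !exprMn B2 /A /v; field; rewrite gt_eqF // v0.
(* Here (B y + A)^2 / kap has the shape required by [gauss_quadratic], and v q^2 = kap a^2 / v
   cancels the exponent of [w'], leaving the factor sqrt v. *)
have gE x : (\int[lebesgue_measure]_y g (x, y) = (w x * Num.sqrt (1 + u x))%:E)%E.
  pose q := Num.sqrt kap * a x / v x.
  transitivity ((w' x)%:E * \int[lebesgue_measure]_y
      (phi y * expR ((Num.sqrt ((v x - 1) / v x) * y + q) ^+ 2 / 2))%:E)%E.
    rewrite -ge0_integralZl_EFin //.
    - apply: eq_integral => y _; rewrite -EFinM.
      have BE : B x = Num.sqrt kap * Num.sqrt ((v x - 1) / v x).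
        by rewrite /B -mulrA sqrtrM ?(ltW kap0) // /v [1 + _]addrC addrK.
      have lE : (B x * y + A x) ^+ 2 / kap =
          (Num.sqrt ((v x - 1) / v x) * y + q) ^+ 2.
        have kE : kap = Num.sqrt kap ^+ 2 by rewrite sqr_sqrtr ?(ltW kap0).
        have k0 : Num.sqrt kap != 0 by rewrite gt_eqF ?sqrtr_gt0.
        have AE : A x = Num.sqrt kap * q by rewrite /A {1}kE expr2 /q !mulrA.
        by rewrite BE AE -mulrA -mulrDr exprMn {2}kE mulrC mulKf // expf_neq0.
      by rewrite /g /= lE (mulrC (phi y) (w' x)) -mulrA.
    - by move=> y _; rewrite lee_fin mulr_ge0 ?expR_ge0.
    - apply/measurable_EFinP; apply: measurable_funM; first exact: measurable_normal_pdf.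
      apply: measurableT_comp => //; apply: measurable_funM => //.
      by apply: measurable_funX; apply: measurable_funD => //; exact: measurable_funM.
  rewrite gauss_quadratic // -EFinM /w' mulrACA -expRD -/(v x).
  rewrite (_ : _ + _ = 0) ?expR0 ?mulr1 //.
  by rewrite /q !exprMn sqr_sqrtr ?(ltW kap0) //; field; rewrite gt_eqF.
have -> := eq_integral _ _ (fun x _ => esym (fE x)) : (_ = _ :> \bar R).
have -> := eq_integral _ _ (fun x _ => esym (gE x)) : (_ = _ :> \bar R).
(* After exchanging the integrals the comparison is made for each fixed [y], where the exponent is
   linear in [eta] with coefficients from the past. *)
rewrite (fubini_tonelli f mf f0) (fubini_tonelli g mg g0).
apply: ge0_le_integral => //.
- by move=> y _; exact: integral_ge0.
- exact: measurable_fun_fubini_tonelli_G.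
- exact: measurable_fun_fubini_tonelli_G.
move=> y _.
have msub : measurable_fun (setT : set F) (fun x => phi y * w' x).
  exact: measurable_funM.
have mlsub : measurable_fun (setT : set F) (fun x => B x * y + A x).
  by apply: measurable_funD => //; exact: measurable_funM.
apply: le_trans (subgauss_integral gen_measurable meas_eta subgauss msub mlsub _) _.
  by move=> x; rewrite mulr_ge0.
have msubO := sub_measurable_fun gen_measurable msub.
have mlsubO := sub_measurable_fun gen_measurable mlsub.
apply: ge0_le_integral => //.
- by move=> x _; rewrite lee_fin !mulr_ge0 ?expR_ge0.
- apply/measurable_EFinP; apply: measurable_funM => //.
  apply: measurableT_comp => //; apply: measurable_funM => //.
  by apply: measurable_funM => //; exact: measurable_funX.
- apply/measurable_EFinP; apply: measurable_funM => //.
  apply: measurableT_comp => //; apply: measurable_funM => //.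
  by apply: measurable_funM => //; exact: measurable_funX.
move=> x _; rewrite lee_fin ler_wpM2l ?mulr_ge0 // ler_expR ler_pM2r //.
by rewrite ler_wpM2l ?sqr_ge0 // -[leRHS]mul1r ler_pdivlMr // mulrC.
Qed.

End MixtureStep.

(** * The self-normalized supermartingale *)

Section MatrixMeasurability.
Variables (dsp : measure_display) (T : measurableType dsp) (R : realType).

Definition mx_measurable m n (A : T -> 'M[R]_(m, n)) :=
  forall i j, measurable_fun setT (fun w => A w i j).

Lemma mx_measurable_mul m n p (A : T -> 'M[R]_(m, n)) (B : T -> 'M[R]_(n, p)) :
  mx_measurable A -> mx_measurable B -> mx_measurable (fun w => A w *m B w).
Proof.
move=> mA mB i j; under eq_fun do rewrite mxE.
by apply: measurable_sum => k; exact: measurable_funM.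
Qed.

Lemma mx_measurable_tr m n (A : T -> 'M[R]_(m, n)) :
  mx_measurable A -> mx_measurable (fun w => (A w)^T).
Proof. by move=> mA i j; under eq_fun do rewrite mxE; exact: mA. Qed.

Lemma mx_measurable_add m n (A B : T -> 'M[R]_(m, n)) :
  mx_measurable A -> mx_measurable B -> mx_measurable (fun w => A w + B w).
Proof. by move=> mA mB i j; under eq_fun do rewrite mxE; exact: measurable_funD. Qed.

Lemma measurable_det n (A : T -> 'M[R]_n) :
  mx_measurable A -> measurable_fun setT (fun w => \det (A w)).
Proof.
move=> mA; apply: measurable_sum => s; apply: measurable_funM => //.
by apply: measurable_prod => i _; exact: mA.
Qed.

(** The entries are cofactors divided by the determinant, which is positive. *)
Lemma mx_measurable_inv n (A : T -> 'M[R]_n) :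
  (forall w, posdef (A w)) -> mx_measurable A ->
  mx_measurable (fun w => invmx (A w)).
Proof.
move=> pA mA i j.
under eq_fun do rewrite /invmx posdef_unit // mxE [(\adj _) _ _]mxE.
apply: measurable_funM.
  apply: measurable_fun_inv; last exact: measurable_det.
  by move=> w; have /andP[] := posdef_det (pA w).
rewrite /cofactor; apply: measurable_funM => //; apply: measurable_det => k l.
by under eq_fun do rewrite !mxE; exact: mA.
Qed.

Lemma measurable_bform d (A : T -> 'M[R]_d) (x y : T -> 'rV[R]_d) :
  mx_measurable A -> mx_measurable x -> mx_measurable y ->
  measurable_fun setT (fun w => bform (A w) (x w) (y w)).
Proof.
move=> mA mx my; apply: (mx_measurable_mul _ _ 0 0); last exact: mx_measurable_tr.
exact: mx_measurable_mul.
Qed.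

Variables (d : nat) (lam : R) (X : nat -> T -> 'rV[R]_d) (e : nat -> T -> R).
Hypothesis lam_gt0 : 0 < lam.

Lemma mx_measurable_Vmat n : (forall s, (1 <= s <= n)%N -> mx_measurable (X s)) ->
  mx_measurable (fun w => Vmat lam (X^~ w) n).
Proof.
elim: n => [|n IH] mX; first by move=> i j; under eq_fun do rewrite Vmat0; exact: measurable_cst.
under eq_fun do rewrite VmatS; apply: mx_measurable_add.
  by apply: IH => s /andP[s1 sn]; apply: mX; rewrite s1 ltnW.
have mXn : mx_measurable (X n.+1) by apply: mX; rewrite /= leqnn.
by apply: mx_measurable_mul => //; exact: mx_measurable_tr.
Qed.

Lemma mx_measurable_Wvec n : (forall s, (1 <= s <= n)%N -> mx_measurable (X s)) ->
  (forall s, (1 <= s <= n)%N -> measurable_fun setT (e s)) ->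
  mx_measurable (fun w => Wvec (X^~ w) (e^~ w) n).
Proof.
elim: n => [|n IH] mX me.
  by move=> i j; under eq_fun do rewrite /Wvec big_geq // mxE; exact: measurable_cst.
under eq_fun do rewrite WvecS; apply: mx_measurable_add.
  by apply: IH => s /andP[s1 sn]; [apply: mX|apply: me]; rewrite s1 ltnW.
move=> i j; under eq_fun do rewrite mxE.
by apply: measurable_funM; [apply: me|apply: mX]; rewrite /= leqnn.
Qed.

Lemma mx_measurable_invV n : (forall s, (1 <= s <= n)%N -> mx_measurable (X s)) ->
  mx_measurable (fun w => invmx (Vmat lam (X^~ w) n)).
Proof.
move=> mX; apply: mx_measurable_inv; last exact: mx_measurable_Vmat.
by move=> w; exact: posdef_Vmat.
Qed.

Lemma measurable_width n : (forall s, (1 <= s <= n.+1)%N -> mx_measurable (X s)) ->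
  measurable_fun setT (fun w => width lam (X^~ w) n.+1).
Proof.
move=> mX; apply: measurable_bform; try by apply: mX; rewrite /= leqnn.
by apply: mx_measurable_invV => s /andP[s1 sn]; apply: mX; rewrite s1 ltnW.
Qed.

Lemma measurable_potential n : (forall s, (1 <= s <= n)%N -> mx_measurable (X s)) ->
  measurable_fun setT (fun w => potential lam (X^~ w) n).
Proof.
elim: n => [|n IH] mX.
  by under eq_fun do rewrite /potential big_geq //; exact: measurable_cst.
under eq_fun do rewrite potentialS; apply: measurable_funM.
  by apply: IH => s /andP[s1 sn]; apply: mX; rewrite s1 ltnW.
by apply: measurable_funD => //; exact: measurable_width.
Qed.

Lemma measurable_noise2 n : (forall s, (1 <= s <= n)%N -> mx_measurable (X s)) ->
  (forall s, (1 <= s <= n)%N -> measurable_fun setT (e s)) ->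
  measurable_fun setT (fun w => noise2 lam (X^~ w) (e^~ w) n).
Proof.
move=> mX me; apply: measurable_bform.
- exact: mx_measurable_invV.
- exact: mx_measurable_Wvec.
- exact: mx_measurable_Wvec.
Qed.

Definition self_norm (kap : R) (n : nat) (w : T) : R :=
  expR (kap * noise2 lam (X^~ w) (e^~ w) n / 2) / Num.sqrt (potential lam (X^~ w) n).

Lemma self_norm_ge0 kap n w : 0 <= self_norm kap n w.
Proof. by rewrite divr_ge0 ?expR_ge0 ?sqrtr_ge0. Qed.

Lemma measurable_self_norm kap n :
  (forall s, (1 <= s <= n)%N -> mx_measurable (X s)) ->
  (forall s, (1 <= s <= n)%N -> measurable_fun setT (e s)) ->
  measurable_fun setT (self_norm kap n).
Proof.
move=> mX me; apply: measurable_funM.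
  apply: measurableT_comp => //; apply: measurable_funM => //.
  by apply: measurable_funM => //; exact: measurable_noise2.
apply: measurable_fun_inv; last exact/measurable_fun_sqrt/measurable_potential.
by move=> w; rewrite sqrtr_gt0 (lt_le_trans ltr01) // potential_ge1.
Qed.

End MatrixMeasurability.

(** * The supermartingale bound and the confidence events *)

Section SelfNormalized.
Variables (dsp : measure_display) (Omega : measurableType dsp) (R : realType).
Variables (P : probability Omega R) (d T : nat) (Rn lam : R).
Variables (theta : 'rV[R]_d) (eta : nat -> Omega -> R) (X : nat -> Omega -> 'rV[R]_d).
Let Y := fun s w => dotv theta (X s w) + eta s w.
Hypothesis lam_gt0 : 0 < lam.
Hypothesis meas_eta : forall t, measurable_fun setT (eta t).
Hypothesis meas_X : forall t (i : 'I_d), measurable_fun setT (fun w => X t w 0 i).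
Hypothesis subgauss : forall t, (1 <= t <= T)%N -> forall (l : R) (G : set Omega),
  hist_sigma X Y t G ->
  (\int[P]_(w in G) (expR (l * eta t w))%:E
     <= (expR (l ^+ 2 * Rn ^+ 2 / 2))%:E * P G)%E.

(** The generators in [hist_sigma], isolated so that the past can be used as a measurable type of
    its own. *)
Definition hist_gen (Z : nat -> Omega -> R) (t : nat) : set (set Omega) :=
  [set G | (exists s (i : 'I_d) (B : set R),
               [/\ (1 <= s <= t)%N, measurable B & G = (fun w => X s w 0 i) @^-1` B])
        \/ (exists s (B : set R),
               [/\ (1 <= s < t)%N, measurable B & G = Z s @^-1` B])].

Local Notation F t := (g_sigma_algebraType (hist_gen Y t)).

Lemma mx_measurable_X s : mx_measurable (X s).
Proof. by move=> i j; rewrite (ord1 i). Qed.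

Lemma measurable_dotv_theta s : measurable_fun setT (fun w => dotv theta (X s w)).
Proof.
under eq_fun do rewrite dotvE.
by apply: measurable_sum => i; exact: measurable_funM.
Qed.

Lemma hist_gen_measurable t : hist_gen Y t `<=` measurable.
Proof.
move=> G [[s [i [B [_ mB ->]]]]|[s [B [_ mB ->]]]].
  by rewrite -[X in measurable X]setTI; exact: meas_X.
rewrite -[X in measurable X]setTI.
by apply: (measurable_funD (measurable_dotv_theta s) (meas_eta s)).
Qed.

Lemma hist_measurable_X t s : (1 <= s <= t)%N -> mx_measurable (X s : F t -> _).
Proof.
move=> st i j _ B mB; rewrite setTI (ord1 i); apply: sub_sigma_algebra.
by left; exists s, j, B.
Qed.

(** Past noises are recovered by subtracting the mean reward from the observed one. *)
Lemma hist_measurable_eta t s : (1 <= s < t)%N ->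
  measurable_fun (setT : set (F t)) (eta s).
Proof.
move=> st.
have mY : measurable_fun (setT : set (F t)) (Y s).
  by move=> _ B mB; rewrite setTI; apply: sub_sigma_algebra; right; exists s, B.
rewrite (_ : eta s = fun w => Y s w - dotv theta (X s w)); last first.
  by apply/funext => w; rewrite /Y addrC addKr.
apply: measurable_funB => //; under eq_fun do rewrite dotvE.
apply: measurable_sum => i; apply: measurable_funM => //.
by apply: hist_measurable_X; case/andP: st => -> /ltnW.
Qed.

(** Round n + 1 is [mixture_step] with weight M_n / sqrt (1 + u), known before the new noise is
    drawn; the factor sqrt (1 + u) it produces cancels the denominator and leaves the integral of
    M_n. *)
Lemma integral_self_norm_le1 kap n : 0 < kap -> kap * Rn ^+ 2 <= 1 ->
  (n <= T)%N -> (\int[P]_w (self_norm lam X eta kap n w)%:E <= 1)%E.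
Proof.
move=> kap0 kapRn; elim: n => [|n IH] nT.
  under eq_integral => w _.
    rewrite /self_norm /noise2 /wnorm2 /Wvec /potential !big_geq // !mul0mx mxE.
    rewrite mulr0 mul0r expR0 sqrtr1 divr1; over.
  by rewrite integral_cst // mul1e probability_le1.
have mXF s : (1 <= s <= n.+1)%N -> mx_measurable (X s : F n.+1 -> _).
  exact: hist_measurable_X.
have mXF' s : (1 <= s <= n)%N -> mx_measurable (X s : F n.+1 -> _).
  by move=> /andP[s1 sn]; apply: mXF; rewrite s1 ltnW.
have meF s : (1 <= s <= n)%N -> measurable_fun (setT : set (F n.+1)) (eta s).
  by move=> sn; exact: (@hist_measurable_eta n.+1 s sn).
pose u w := width lam (X^~ w) n.+1.
pose a w := bform (invmx (Vmat lam (X^~ w) n)) (Wvec (X^~ w) (eta^~ w) n) (X n.+1 w).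
pose wgt w := self_norm lam X eta kap n w / Num.sqrt (1 + u w).
have u0 w : 0 <= u w by exact: width_ge0.
have s0 w : 0 < Num.sqrt (1 + u w) by rewrite sqrtr_gt0 ltr_pwDl.
have wgt0 w : 0 <= wgt w by rewrite divr_ge0 ?self_norm_ge0 // ltW.
have mu : measurable_fun (setT : set (F n.+1)) u.
  exact: (measurable_width (T := F n.+1)).
have ma : measurable_fun (setT : set (F n.+1)) a.
  apply: (measurable_bform (T := F n.+1)).
  - exact: (mx_measurable_invV (T := F n.+1)).
  - exact: (mx_measurable_Wvec (T := F n.+1)).
  - by apply: mXF; rewrite /= leqnn.
have mwgt : measurable_fun (setT : set (F n.+1)) wgt.
  apply: measurable_funM; first exact: (measurable_self_norm (T := F n.+1)).
  apply: measurable_fun_inv => //.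
  by apply: measurable_fun_sqrt; exact: measurable_funD.
have sg : forall l (G : set Omega), <<s hist_gen Y n.+1 >> G ->
    (\int[P]_(w in G) (expR (l * eta n.+1 w))%:E
     <= (expR (l ^+ 2 * Rn ^+ 2 / 2))%:E * P G)%E.
  by move=> l G hG; apply: subgauss.
have step := mixture_step (hist_gen_measurable (t := n.+1)) (meas_eta n.+1) sg
  kap0 kapRn ma mu mwgt u0 wgt0.
apply: le_trans (IH (ltnW nT)); apply: le_trans (le_trans _ step) _.
  rewrite le_eqVlt; apply/orP; left; apply/eqP; apply: eq_integral => w _.
  congr (_%:E); rewrite /wgt /self_norm noise2S // potentialS.
  rewrite sqrtrM; last by rewrite (le_trans ler01) // potential_ge1.
  rewrite -/(u w) -/(a w) mulrDr mulrDl expRD invfM.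
  by rewrite -!mulrA; congr (_ * _); rewrite mulrC -!mulrA.
rewrite le_eqVlt; apply/orP; left; apply/eqP; apply: eq_integral => w _.
by rewrite /wgt divfK // gt_eqF.
Qed.

Variable L : R.
Hypothesis d_gt0 : (0 < d)%N.
Hypothesis X_le : forall s w, (1 <= s <= T)%N -> dotv (X s w) (X s w) <= L ^+ 2.

(** Multiplied by [Rn ^+ 2], this is the square of the first summand in the root of beta. *)
Definition conf_level (t : nat) : R :=
  d%:R * ln ((1 + (t.-1)%:R * L ^+ 2 / lam) / (t%:R ^+ 2)^-1).

Definition conf_fail (c : R) (t : nat) : set Omega :=
  [set w | c * conf_level t < noise2 lam (X^~ w) (eta^~ w) t.-1].

Lemma conf_fail_measurable c t : measurable (conf_fail c t).
Proof.
have mN : measurable_fun setT (fun w => noise2 lam (X^~ w) (eta^~ w) t.-1).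
  by apply: measurable_noise2 => // s _; exact: mx_measurable_X.
rewrite (_ : conf_fail c t = setT `&`
    (fun w => noise2 lam (X^~ w) (eta^~ w) t.-1) @^-1` `]c * conf_level t, +oo[).
  by apply: mN => //; exact: measurable_itv.
by rewrite setTI; apply/seteqP; split=> w /=; rewrite in_itv /= andbT.
Qed.

Let lin_ge1 t : 1 <= 1 + t%:R * L ^+ 2 / lam.
Proof. by rewrite lerDl divr_ge0 ?(ltW lam_gt0) // mulr_ge0 ?sqr_ge0. Qed.

Lemma conf_level_ge0 t : (1 <= t)%N -> 0 <= conf_level t.
Proof.
by move=> t1; rewrite mulr_ge0 // invrK ln_ge0 // mulr_ege1 // exprn_ege1 // ler1n.
Qed.

(** After squaring, the left-hand side is at most t^2 (1 + (t - 1) L^2 / lam)^d, and t^2 <= t^(2 d)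
    because d >= 1. *)
Lemma conf_level_exp t w : (1 <= t <= T)%N ->
  t%:R * Num.sqrt (potential lam (X^~ w) t.-1) <= expR (conf_level t / 2).
Proof.
move=> /andP[t1 tT].
have tr : 1 <= (t%:R : R) by rewrite ler1n.
have t0 : 0 < (t%:R : R) := lt_le_trans ltr01 tr.
have p1 := potential_ge1 lam_gt0 (X^~ w) t.-1.
rewrite -(ler_pXn2r (n := 2)) ?nnegrE ?mulr_ge0 ?sqrtr_ge0 ?expR_ge0 ?(ltW t0) //.
rewrite exprMn sqr_sqrtr ?(le_trans ler01) // -expRM_natl.
rewrite (_ : 2%:R * (conf_level t / 2) = conf_level t); last by field.
rewrite /conf_level invrK expRM_natl lnK; last first.
  by rewrite posrE mulr_gt0 ?exprn_gt0 // (lt_le_trans ltr01).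
rewrite exprMn mulrC ler_pM ?exprn_ge0 ?(le_trans ler01 p1) //.
- apply: potential_le => // s /andP[s1 st]; apply: X_le.
  by rewrite s1 (leq_trans st) // (leq_trans (leq_pred t)).
- by rewrite -[leLHS]expr1 ler_weXn2l // exprn_ege1.
Qed.

(** On the failure event [conf_level_exp] forces M_{t-1} >= t, so Markov's inequality applies. *)
Lemma conf_fail_kap kap t : (1 <= t <= T)%N -> 0 < kap -> kap * Rn ^+ 2 <= 1 ->
  (P (conf_fail kap^-1 t) <= (t%:R^-1)%:E)%E.
Proof.
move=> tT kap0 kapRn; have /andP[t1 tT'] := tT.
have t0 : 0 < (t%:R : R) by rewrite ltr0n.
have mS : measurable_fun setT (self_norm lam X eta kap t.-1).
  by apply: measurable_self_norm => // s _; exact: mx_measurable_X.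
have mM : measurable_fun setT (fun w => (self_norm lam X eta kap t.-1 w)%:E).
  exact/measurable_EFinP.
have := le_integral_abse P measurableT mM t0.
rewrite setTI => markov_t.
rewrite -(lee_pmul2l _ (_ : 0 < t%:R%:E)%E) ?lte_fin // -EFinM divff ?gt_eqF //.
have I1 := integral_self_norm_le1 kap0 kapRn (leq_trans (leq_pred t) tT').
apply: le_trans (le_trans markov_t _); last first.
  under eq_integral do rewrite abse_EFin ger0_norm ?self_norm_ge0 //.
  exact: I1.
rewrite lee_pmul2l ?lte_fin //; apply: le_measure; rewrite ?inE.
- exact: conf_fail_measurable.
- rewrite (_ : [set w | _] = setT `&`
      self_norm lam X eta kap t.-1 @^-1` `[t%:R, +oo[).
    by apply: mS => //; exact: measurable_itv.
  rewrite setTI; apply/seteqP; split=> w /=;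
    by rewrite in_itv /= andbT lee_fin ger0_norm ?self_norm_ge0.
move=> w /= hw; rewrite lee_fin ger0_norm ?self_norm_ge0 //.
have p0 : 0 < Num.sqrt (potential lam (X^~ w) t.-1).
  by rewrite sqrtr_gt0 (lt_le_trans ltr01) // potential_ge1.
rewrite /self_norm ler_pdivlMr // (le_trans (conf_level_exp w tT)) //.
by rewrite ler_expR ler_pM2r // ltW // -ltr_pdivrMl.
Qed.

(* At [c = Rn^2] the weight [1 / c] may be junk ([Rn = 0]), hence the limit
   from above. *)
Lemma conf_fail_prob t : (1 <= t <= T)%N ->
  (P (conf_fail (Rn ^+ 2) t) <= (t%:R^-1)%:E)%E.
Proof.
move=> tT; have /andP[t1 _] := tT.
have l0 := conf_level_ge0 t1.
pose Fk k := conf_fail (Rn ^+ 2 + k.+1%:R^-1) t.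
have FE : conf_fail (Rn ^+ 2) t = \bigcup_k Fk k.
  apply/seteqP; split=> w /=; last first.
    move=> [k _]; apply: le_lt_trans; rewrite ler_wpM2r // lerDl.
    by rewrite invr_ge0.
  rewrite /conf_fail /= => hw; set N := noise2 _ _ _ _ in hw.
  (* The strict inequality leaves room for a slightly larger constant; the 1 in the denominator
     guards against a zero level. *)
  have e0 : 0 < (N - Rn ^+ 2 * conf_level t) / (1 + conf_level t).
    by rewrite divr_gt0 ?subr_gt0 // ltr_pwDl.
  have [k hk] := ltr_add_invr (e0 : 0 < _); exists k => //.
  rewrite /Fk /conf_fail /= mulrDl -ltrBrDl.
  have c0 : 0 < 1 + conf_level t by rewrite ltr_pwDl.
  move: hk; rewrite add0r ltr_pdivlMr // => hk; apply: le_lt_trans hk.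
  by rewrite ler_pM2l ?invr_gt0 // lerDr.
have mFk k : measurable (Fk k) by exact: conf_fail_measurable.
rewrite FE.
(* Continuity of the measure along the increasing events [Fk], each of probability at most 1 / t. *)
have cvgF := nondecreasing_cvg_mu (mu := P) mFk (bigcup_measurable (fun k _ => mFk k)).
have /cvgF {}cvgF : {homo Fk : n m / (n <= m)%N >-> (n <= m)%O}.
  move=> n m nm; apply/subsetPset => w; rewrite /Fk /conf_fail /=.
  apply: le_lt_trans; rewrite ler_wpM2r // lerD2l lef_pV2 ?posrE ?ltr0n //.
  by rewrite ler_nat.
rewrite -(cvg_lim _ cvgF) //; apply: lime_le; first by apply/cvg_ex; eexists; exact: cvgF.
near=> k; rewrite /= /Fk.
have k0 : 0 < (k.+1%:R^-1 : R) by rewrite invr_gt0 ltr0n.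
have c0 : 0 < Rn ^+ 2 + k.+1%:R^-1 by rewrite ltr_wpDl ?sqr_ge0.
rewrite -[X in conf_fail X]invrK; apply: conf_fail_kap => //; first by rewrite invr_gt0.
by rewrite mulrC ler_pdivrMr // mul1r lerDl ltW.
Unshelve. all: by end_near. Qed.

End SelfNormalized.

(** * Expected regret *)

(** Outside the failure event, the bracket in [estimation_error] is at most the root of beta, which
    is the hypothesis of [regret_pulled]. *)
Lemma regret_split (R : realType) (d : nat) (Rn S L lam C : R)
    (theta : 'rV[R]_d) (At : set 'rV[R]_d) (eta : nat -> R)
    (X : nat -> 'rV[R]_d) (lead : 'rV[R]_d) (t : nat) :
  0 <= Rn -> 0 < lam -> 1 <= Num.sqrt lam * S -> 1 <= C ->
  enorm theta <= S ->
  (forall x, At x -> enorm x <= L) ->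
  noise2 lam X eta t.-1 <= Rn ^+ 2 * conf_level d lam L t ->
  let Y := fun s => dotv theta (X s) + eta s in
  At lead -> ucb Rn S L lam X Y t lead = sup (ucb Rn S L lam X Y t @` At) ->
  At (X t) ->
  (forall x, At x -> (linimed3_index Rn S L lam C X Y t At lead (X t)
     <= linimed3_index Rn S L lam C X Y t At lead x)%E) ->
  sup (dotv theta @` At) - dotv theta (X t) <=
  (Num.sqrt (Num.max 1 (ln C)) + 2) * Num.sqrt (gidx Rn S L lam X t (X t)).
Proof.
move=> Rn0 lam0 lamS C1 thS A_le good Y A_lead U_lead A_X X_min.
apply: (regret_pulled Rn0 lam0 lamS C1 A_le A_lead U_lead A_X X_min) => x.
rewrite (le_trans (estimation_error lam0 X eta t.-1 x thS)) //.
rewrite ler_wpM2r ?sqrtr_ge0 // sqrtr_sqr.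
apply: le_trans (ler_norm _); rewrite lerD2r.
rewrite -[X in X * _](ger0_norm Rn0) -sqrtr_sqr -sqrtrM ?sqr_ge0 //.
exact: ler_wsqrtr.
Qed.

(** The horizon starts at 2 because ln 1 = 0 would make the bound vanish for a single round. *)
Theorem theorem3 (R : realType) (Rn S L lam C : R) :
  0 <= Rn -> 0 < lam -> 1 <= Num.sqrt lam * S -> 1 <= C ->
  exists K : R, forall (d T : nat), (2 <= T)%N ->
  forall (dsp : measure_display) (Omega : measurableType dsp)
         (P : probability Omega R)
         (theta : 'rV[R]_d) (A : nat -> set 'rV[R]_d)
         (eta : nat -> Omega -> R)
         (X : nat -> Omega -> 'rV[R]_d) (Lead : nat -> Omega -> 'rV[R]_d),
  let Y := fun s w => dotv theta (X s w) + eta s w in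
  (* Assumption 1 *)
  (forall t, (1 <= t <= T)%N -> A t !=set0) ->
  (forall t x, (1 <= t <= T)%N -> A t x -> enorm x <= L) ->
  enorm theta <= S ->
  (forall t y, (1 <= t <= T)%N -> A t y ->
     sup (dotv theta @` A t) - dotv theta y <= 1) ->
  (* the noise and the pulled arms are random variables *)
  (forall t, measurable_fun setT (eta t)) ->
  (forall t (i : 'I_d), measurable_fun setT (fun w => X t w 0 i)) ->
  (* conditional R-sub-Gaussian noise given A_1..A_t, Y_1..Y_{t-1} *)
  (forall t, (1 <= t <= T)%N -> forall (l : R) (G : set Omega),
     hist_sigma X Y t G ->
     (\int[P]_(w in G) (expR (l * eta t w))%:E
        <= (expR (l ^+ 2 * Rn ^+ 2 / 2))%:E * P G)%E) ->
  (* LinIMED-3 (arbitrary tie-breaking, in the leader and in the argmin) *)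
  (forall t, (1 <= t <= T)%N -> forall w,
     let Xw := fun s => X s w in
     let Yw := fun s => Y s w in
     [/\ A t (Lead t w),
         ucb Rn S L lam Xw Yw t (Lead t w)
           = sup (ucb Rn S L lam Xw Yw t @` A t),
         A t (X t w) &
         forall x, A t x ->
           (linimed3_index Rn S L lam C Xw Yw t (A t) (Lead t w) (X t w)
            <= linimed3_index Rn S L lam C Xw Yw t (A t) (Lead t w) x)%E]) ->
  (\int[P]_w (\sum_(1 <= t < T.+1)
                 (sup (dotv theta @` A t) - dotv theta (X t w)))%:E
     <= (K * d%:R * Num.sqrt T%:R * ln T%:R)%:E)%E.
Proof.
move=> Rn0 lam0 lamS C1.
pose c := Num.sqrt (Num.max 1 (ln C)) + 2.
have c1 : 1 <= c by have := sqrtr_ge0 (Num.max 1 (ln C)); rewrite /c; lra.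
(* The first two terms pay for the harmonic sum 1 + ln T of the failure probabilities, the last one
   for the rounds where the confidence bound holds. *)
exists ((ln 2)^-1 + 1 + sum_coef c Rn S L lam) => d T T2 dsp Omega P theta A eta X Lead Y.
move=> A0 A_le thS gap1 meas_eta meas_X subgauss algo.
(* In dimension 0 all rewards are 0; the arm sets being nonempty, the supremum is that of the
   singleton 0. *)
have [d0|d_gt0] := posnP d.
  subst d; rewrite mulr0 !mul0r.
  have dot0 (x : 'rV[R]_0) : dotv theta x = 0 by rewrite dotvE big_ord0.
  rewrite (eq_integral (fun=> 0%E)) ?integral0 // => w _.
  rewrite big_nat big1 // => t tT; rewrite dot0 subr0.
  rewrite (_ : _ @` _ = [set 0]) ?sup1 //; apply/seteqP; split=> [_ [x _ <-]//|_ ->].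
  by have [x Ax] := A0 t tT; exists x.
have X_le s w : (1 <= s <= T)%N -> dotv (X s w) (X s w) <= L ^+ 2.
  move=> sT; have [_ _ AX _] := algo s sT w; have XL := A_le s _ sT AX.
  rewrite -(sqr_sqrtr (dotv_ge0 _)) lerXn2r ?nnegrE ?sqrtr_ge0 //.
  exact: le_trans (sqrtr_ge0 _) XL.
pose bad t := conf_fail lam eta X L (Rn ^+ 2) t.
have mbad t : measurable (bad t) by apply: conf_fail_measurable.
have bad_prob t : (1 <= t <= T)%N -> (P (bad t) <= (t%:R^-1)%:E)%E.
  exact: (conf_fail_prob lam0 meas_eta meas_X subgauss d_gt0 X_le).
pose D := d%:R * ln T%:R * Num.sqrt T%:R : R.
pose K1 := sum_coef c Rn S L lam * D.
pose reg t w := sup (dotv theta @` A t) - dotv theta (X t w).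
have reg0 t w : (1 <= t <= T)%N -> 0 <= reg t w.
  move=> tT; have [_ _ AX _] := algo t tT w.
  exact: (regret_ge0 (X := X^~ w) (t := t) (fun x => A_le t x tT) AX theta).
(* The gap assumption bounds the regret by 1 on the failure event, and also supplies the cap at 1
   outside it. *)
have reg_le t w : (1 <= t <= T)%N -> reg t w <=
    \1_(bad t) w + Num.min 1 (c * Num.sqrt (gidx Rn S L lam (X^~ w) t (X t w))).
  move=> tT; have [A_lead U_lead A_X X_min] := algo t tT w.
  rewrite indicE; case: (boolP (w \in bad t)) => [_|].
    rewrite (le_trans (gap1 t _ tT A_X)) // lerDl le_min ler01 mulr_ge0 ?sqrtr_ge0 //.
    exact: le_trans ler01 c1.
  rewrite notin_setE /bad /conf_fail /= => /negP; rewrite -leNgt => good.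
  rewrite add0r le_min gap1 //=.
  exact: (@regret_split _ _ Rn S L lam C theta (A t) (eta^~ w) (X^~ w) (Lead t w) t
    Rn0 lam0 lamS C1 thS (fun x => A_le t x tT) good A_lead U_lead A_X X_min).
have sum_le w : \sum_(1 <= t < T.+1) reg t w <=
    \sum_(1 <= t < T.+1) \1_(bad t) w + K1.
  apply: (@le_trans _ _ (\sum_(1 <= t < T.+1) (\1_(bad t) w +
    Num.min 1 (c * Num.sqrt (gidx Rn S L lam (X^~ w) t (X t w)))))).
    by apply: ler_sum_nat => t tT; exact: reg_le.
  rewrite big_split /= lerD2l /K1 /D mulrA.
  by apply: (@sum_gidx_le _ _ _ _ _ _ _ (X^~ w)) => // s; exact: X_le.
have K10 : 0 <= K1.
  by rewrite !mulr_ge0 ?sqrtr_ge0 // ln_ge0 // ler1n (leq_trans _ T2).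
have mreg t : measurable_fun setT (reg t).
  by apply: measurable_funB => //; apply: measurable_dotv_theta.
apply: (@le_trans _ _
    (\int[P]_w (\sum_(t <- index_iota 1 T.+1) (\1_(bad t) w)%:E + K1%:E))%E).
  apply: ge0_le_integral => //.
  - move=> w _; rewrite lee_fin big_nat; apply: sumr_ge0 => t; exact: reg0.
  - by apply/measurable_EFinP; exact: measurable_sum.
  - apply: emeasurable_funD => //; apply: emeasurable_sum => t.
    by apply/measurable_EFinP; exact: measurable_indic (mbad t).
  - by move=> w _; rewrite sumEFin -EFinD lee_fin; exact: sum_le.
rewrite ge0_integralD //; last 2 first.
- by move=> w _; rewrite sume_ge0 // => t _; rewrite lee_fin indic_ge0.
- apply: emeasurable_sum => t.
  by apply/measurable_EFinP; exact: measurable_indic (mbad t).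
rewrite ge0_integral_sum //; last first.
  by move=> t; apply/measurable_EFinP; exact: measurable_indic (mbad t).
have -> : (\int[P]_w K1%:E = K1%:E)%E.
  transitivity (K1%:E * P setT)%E; first exact: integral_cst.
  by rewrite probability_setT mule1.
have sum_bad : (\sum_(t <- index_iota 1 T.+1) \int[P]_w (\1_(bad t) w)%:E
    <= (\sum_(1 <= t < T.+1) (t%:R : R)^-1)%:E)%E.
  rewrite -sumEFin big_seq [leRHS]big_seq; apply: lee_sum => t.
  by rewrite mem_index_iota ltnS => tT; rewrite integral_indic // setIT bad_prob.
apply: le_trans (leeD2r _ sum_bad) _; rewrite -EFinD lee_fin.
have lnT : ln 2 <= ln (T%:R : R) by exact: ln2_leT.
have l2 := ln2_gt0 R.
have harm : \sum_(1 <= t < T.+1) (t%:R : R)^-1 <= 1 + ln T%:R.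
  by have := harmonic_le R T.-1; rewrite (prednK (ltnW T2)).
(* The logarithmic cost of the failures is absorbed, since d and sqrt T are at least 1. *)
have D_ge : ln T%:R <= D.
  rewrite /D mulrAC ler_peMl ?(le_trans (ltW l2)) // mulr_ege1 ?ler1n //.
  by rewrite -[leLHS]sqrtr1 ler_wsqrtr // ler1n (leq_trans _ T2).
have one_le : 1 <= (ln 2)^-1 * ln (T%:R : R).
  by rewrite ler_pdivlMl ?mulr1.
rewrite (_ : _ * Num.sqrt T%:R * ln T%:R = ((ln 2)^-1 + 1) * D + K1); last first.
  by rewrite /K1 /D; ring.
rewrite lerD2r (le_trans harm) // mulrDl mul1r lerD //.
by rewrite (le_trans one_le) // ler_pM2l ?invr_gt0.
Qed.
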